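(* Let $e\in\mathbb{S}$, let $k$ be a commutative Noetherian ring and let $R$ be a reduced commutative $k$-algebra that is finitely generated as a $k$-module, such that for every prime $p$ dividing $e$ we have $\bigcap_{n\ge0}p^nR=\{0\}$ and multiplication by $p$ is injective on $R$. Then $R$ has a universal abelian $e$-torsion grading (as a $k$-algebra).
   Context: Steinitz numbers $\mathbb{S}$: formal products $\prod_p p^{n_p}$ over primes with $n_p\in\mathbb{Z}_{\ge0}\cup\{\infty\}$; a prime $p$ divides $e$ if $n_p\ge1$, and a positive integer $d$ divides $e$ if $\mathrm{ord}_p(d)\le n_p$ for all $p$. An abelian group is $e$-torsion if every element has finite order dividing $e$. An abelian $e$-torsion grading of $R$ is $(R,\Gamma,\{R_\gamma\}_{\gamma\in\Gamma})$ with $\Gamma$ an abelian $e$-torsion group, $R_\gamma$ $k$-submodules with $\bigoplus R_\gamma\to R$ an isomorphism, $1\in R_1$ and $R_\gamma R_\delta\subseteq R_{\gamma\delta}$. It is universal if for every abelian $e$-torsion grading $(R,\Delta,\{S_\delta\})$ there is a unique homomorphism $\varphi:\Gamma\to\Delta$ with $S_\delta=\sum_{\gamma\in\varphi^{-1}(\delta)}R_\gamma$ for all $\delta$. Reduced means no nonzero nilpotents. *)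

(* Defs.v *)
From HB Require Import structures.
From mathcomp Require Import all_boot all_order all_algebra.
Set Implicit Arguments. Unset Strict Implicit. Unset Printing Implicit Defensive.
Import Order.TTheory GRing.Theory Num.Theory.
Local Open Scope ring_scope.

(* Steinitz numbers: e p = Some n means n_p = n, e p = None means n_p = oo.
   Only the values at primes p are meaningful. *)
Definition steinitz := nat -> option nat.

Definition prime_dvd_st (p : nat) (e : steinitz) : Prop :=
  prime p /\ match e p with None => True | Some n => is_true (0 < n)%N end.

Definition nat_dvd_st (d : nat) (e : steinitz) : Prop :=
  (0 < d)%N /\
  forall p, prime p -> match e p with None => True | Some n => is_true (logn p d <= n)%N end.

Definition is_order (G : zmodType) (g : G) (n : nat) : Prop :=
  [/\ (0 < n)%N, g *+ n = 0 & forall m, (0 < m)%N -> g *+ m = 0 -> (n <= m)%N].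

Definition e_torsion (e : steinitz) (G : zmodType) : Prop :=
  forall g : G, exists n, is_order g n /\ nat_dvd_st n e.

Definition grp_hom (G D : zmodType) (phi : G -> D) : Prop :=
  forall x y, phi (x + y) = phi x + phi y.

(* Commutative k-algebras R are given by a ring morphism iota : k -> R;
   the k-module structure is c . r := iota c * r. *)
Section KAlg.
Variables (k R : comPzRingType) (iota : {rmorphism k -> R}).

Definition ksubmod (M : R -> Prop) : Prop :=
  [/\ M 0, forall x y, M x -> M y -> M (x + y)
    & forall (c : k) x, M x -> M (iota c * x)].

Definition kmod_fin_gen : Prop :=
  exists gens : seq R, forall r : R,
    exists cs : seq k, size cs = size gens /\
      r = \sum_(i < size gens) iota (nth 0 cs i) * nth 0 gens i.

(* An abelian grading of R by G, given as a family of submodules G -> R -> Prop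
   (G written additively: 1 lies in the component of 0 and
   M_g M_h is contained in M_(g+h)). The direct sum condition
   (the map (+)_g M_g -> R is an isomorphism) is written out as surjectivity and
   injectivity of the summation map on finitely supported families. *)
Definition is_grading (G : zmodType) (M : G -> R -> Prop) : Prop :=
  [/\ forall g, ksubmod (M g),
      forall r : R, exists (s : seq G) (x : G -> R),
        uniq s /\ (forall g, M g (x g)) /\ r = \sum_(g <- s) x g,
      forall (s : seq G) (x : G -> R), uniq s -> (forall g, M g (x g)) ->
        \sum_(g <- s) x g = 0 -> forall g, g \in s -> x g = 0,
      M 0 1
    & forall g h a b, M g a -> M h b -> M (g + h) (a * b)].

Definition fibre_sum (G D : zmodType) (M : G -> R -> Prop) (phi : G -> D) (d : D)
  (r : R) : Prop :=
  exists (s : seq G) (x : G -> R),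
    (forall g, g \in s -> phi g = d /\ M g (x g)) /\ r = \sum_(g <- s) x g.

Definition universal_grading (e : steinitz) (G : zmodType) (M : G -> R -> Prop)
  : Prop :=
  [/\ e_torsion e G, is_grading M &
    forall (D : zmodType) (S : D -> R -> Prop),
      e_torsion e D -> is_grading S ->
      exists phi : G -> D,
        [/\ grp_hom phi,
            (forall d r, S d r <-> fibre_sum M phi d r) &
            forall psi : G -> D, grp_hom psi ->
              (forall d r, S d r <-> fibre_sum M psi d r) -> forall g, psi g = phi g]].

End KAlg.

Definition is_ideal (k : comPzRingType) (I : k -> Prop) : Prop :=
  [/\ I 0, forall x y, I x -> I y -> I (x + y) & forall c x, I x -> I (c * x)].

Definition noetherian (k : comPzRingType) : Prop :=
  forall I : nat -> k -> Prop, (forall n, is_ideal (I n)) ->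
    (forall n x, I n x -> I n.+1 x) ->
    exists N, forall n x, (N <= n)%N -> I n x -> I N x.

Definition reduced (R : comPzRingType) : Prop :=
  forall (x : R) (n : nat), x ^+ n = 0 -> x = 0.

(* Main.v *)
(* Any two e-torsion gradings of R have commuting projections, hence a common
   refinement. As R is noetherian over k, some e-torsion grading then has components
   that no e-torsion grading splits; the universal grading has the same components,
   and its group is the free abelian group on the degrees of that grading modulo the
   elements killed by every coarsening.

   Characters of the degree groups and the adjunction of a root of unity zeta of order
   N reduce the commutation to gradings by Z/n and Z/n' with n and n' dividing N.
   Refining these one prime at a time leaves a piece L on which the two gradings are
   given by ring automorphisms that are scalar modulo zeta_p - 1 and zeta_p' - 1
   respectively. Their commutator c is the identity modulo (zeta_p - 1)(zeta_p' - 1) on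
   L. Since R[zeta] is reduced and integral over k, the orbits of c are finite modulo
   suitable c-stable ideals, and a finite orbit of an automorphism that close to the
   identity is a fixed point. *)

Require Import Defs.
From HB Require Import structures.
From mathcomp Require Import all_boot all_order all_algebra.
From mathcomp Require Import cyclotomic ring boolp.
Import GRing.Theory Pdiv.CommonRing Pdiv.RingMonic.
Local Open Scope ring_scope.
Local Open Scope quotient_scope.

Set Implicit Arguments.
Unset Strict Implicit.
Unset Printing Implicit Defensive.

(** * Ascending chains of submodules *)

(** A single factor zeta_p - 1 could not suffice: the twist of a Z/p-grading by zeta_p is itself the
    identity modulo zeta_p - 1, and it may have order p. The second factor of the commutator is what
    the descent on orbits needs. Suppose that f^l fixes y for a prime l. Then f y - y is killed by
    the trace 1 + f + ... + f^(l-1). This trace is l modulo zeta_p - 1, and if l = p and f is the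
    identity modulo (zeta_p - 1)^2, it is p modulo p (zeta_p - 1). Dividing by zeta_p - 1 again and
    again makes f y - y infinitely p-divisible, so it vanishes by separatedness. If p and p' differ,
    one of them differs from l. As R need not be a domain, roots of a monic polynomial are counted
    modulo prime ideals that are annihilators of elements of R[zeta]; regularity and separatedness
    of p pass to quotients by annihilators. *)

Definition ascending_stable (T : Type) (F : (T -> Prop) -> Prop) : Prop :=
  forall I : nat -> T -> Prop, (forall n, F (I n)) ->
    (forall n x, I n x -> I n.+1 x) ->
    exists N, forall n x, (N <= n)%N -> I n x -> I N x.

Lemma ascending_stable_sub (T : Type) (F F' : (T -> Prop) -> Prop) :
  (forall A, F A -> F' A) -> ascending_stable F' -> ascending_stable F.
Proof. by move=> sFF acc I FI; apply: acc => n; exact/sFF. Qed.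

Lemma ascending_mono (T : Type) (I : nat -> T -> Prop) :
  (forall n x, I n x -> I n.+1 x) -> forall m n x, (m <= n)%N -> I m x -> I n x.
Proof.
move=> incI m n x /subnK <-; elim: (n - m)%N => //= d IHd /IHd.
by rewrite addSn; exact: incI.
Qed.

Lemma ascending_stable_maximal (T : Type) (F : (T -> Prop) -> Prop) :
  ascending_stable F -> (exists A, F A) ->
  exists2 A, F A & forall B, F B -> (forall x, A x -> B x) -> forall x, B x -> A x.
Proof.
move=> acc [A0 FA0]; apply: contrapT => nomax.
have step (A : {A | F A}) : exists B : {B | F B},
    (forall x, sval A x -> sval B x) /\ exists x, sval B x /\ ~ sval A x.
  apply: contrapT => noB; apply: nomax; exists (sval A); first exact: svalP.
  move=> B FB sAB x Bx; apply: contrapT => nAx; apply: noB.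
  by exists (exist _ B FB); split=> //; exists x.
have [f fP] := choice step.
pose I n := sval (iter n f (exist _ A0 FA0)).
have [|n x|N stab] := acc I; first by move=> n; exact: svalP.
  by have [/(_ x)] := fP (iter n f (exist _ A0 FA0)).
have [_ [x [Bx nAx]]] := fP (iter N f (exist _ A0 FA0)).
by apply: nAx; exact: (stab N.+1).
Qed.

Section FinGen.
Variables (k S : comPzRingType) (iota : {rmorphism k -> S}).

Lemma ksubmodN (M : S -> Prop) : ksubmod iota M -> forall x, M x -> M (- x).
Proof.
by case=> _ _ MZ x /(MZ (-1)); rewrite rmorphN1 mulN1r.
Qed.

Lemma ksubmodB (M : S -> Prop) : ksubmod iota M ->
  forall x y, M x -> M y -> M (x - y).
Proof. by move=> kM x y Mx /(ksubmodN kM); case: kM => _ + _; exact. Qed.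

Lemma ksubmod_sum (M : S -> Prop) (T : Type) (s : seq T) (P : pred T) (x : T -> S) :
  ksubmod iota M -> (forall i, P i -> M (x i)) -> M (\sum_(i <- s | P i) x i).
Proof. by case=> M0 MD _ Mx; elim/big_rec: _ => // i y Pi; exact/MD/Mx. Qed.

(** The condition of [kmod_fin_gen] for one element and one list, isolated to allow induction on the
    generators. *)
Definition kspan (gens : seq S) (r : S) : Prop :=
  exists cs : seq k, size cs = size gens /\
    r = \sum_(i < size gens) iota (nth 0 cs i) * nth 0 gens i.

Lemma kspan_nil r : kspan [::] r -> r = 0.
Proof. by case=> cs [_ ->]; rewrite big_ord0. Qed.

Lemma kspan_cons g gens r :
  kspan (g :: gens) r <-> exists c s, kspan gens s /\ r = iota c * g + s.
Proof.
split=> [[[|c cs] [//= [szc] ->]]|[c [s [[cs [szc ->]] ->]]]].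
  exists c, (\sum_(i < size gens) iota (nth 0 cs i) * nth 0 gens i).
  by split; [exists cs | rewrite big_ord_recl].
by exists (c :: cs); rewrite /= szc big_ord_recl.
Qed.

Lemma kspan_ksubmod gens : ksubmod iota (kspan gens).
Proof.
elim: gens => [|g gens [IH0 IHD IHZ]].
  split=> [|x y /kspan_nil-> /kspan_nil->|c x /kspan_nil->]; rewrite ?addr0 ?mulr0;
  by exists [::]; rewrite big_ord0.
split=> [|x y|c x].
- by apply/kspan_cons; exists 0, 0; rewrite rmorph0 mul0r addr0.
- move=> /kspan_cons[a [s [hs ->]]] /kspan_cons[b [t [ht ->]]].
  apply/kspan_cons; exists (a + b), (s + t); split; first exact: IHD.
  by rewrite rmorphD mulrDl addrACA.
move=> /kspan_cons[a [s [hs ->]]].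
apply/kspan_cons; exists (c * a), (iota c * s); split; first exact: IHZ.
by rewrite rmorphM mulrDr mulrA.
Qed.

Lemma kspan_mem gens g : g \in gens -> kspan gens g.
Proof.
elim: gens => // h gens IH; rewrite inE => /predU1P[->|/IH gs]; apply/kspan_cons.
  by exists 1, 0; split; [case: (kspan_ksubmod gens) | rewrite rmorph1 mul1r addr0].
by exists 0, g; split=> //; rewrite rmorph0 mul0r add0r.
Qed.

(** Induction on the generators: a chain is controlled by the ideals of coefficients that occur at
    the first generator and by its intersections with the span of the others. Both become
    stationary, and elements with the same first coefficient differ by an element of that span. *)
Lemma noetherian_kspan : noetherian k -> forall (gens : seq S) (I : nat -> S -> Prop),
  (forall n, ksubmod iota (I n)) -> (forall n x, I n x -> I n.+1 x) ->
  exists N, forall n x, (N <= n)%N -> kspan gens x -> I n x -> I N x.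
Proof.
move=> acc gens I kI incI; elim: gens => [|g gens [N2 stab2]].
  by exists 0%N => n x _ /kspan_nil-> _; case: (kI 0%N).
have [kS0 kSD kSZ] := kspan_ksubmod gens.
pose J n c := exists s, kspan gens s /\ I n (iota c * g + s).
have [n|n c [s [hs /incI Is]]|N1 stab1] := acc J; last 2 first.
- by exists s.
- exists (maxn N1 N2) => n x; rewrite geq_max => /andP[N1n N2n].
  move=> /kspan_cons[c [s [hs ->]]] Ix.
  have [s' [hs' Is']] : J N1 c by apply: (stab1 n) => //; exists s.
  have IsB : I N2 (s - s').
    apply: (stab2 n) => //; first exact: (ksubmodB (kspan_ksubmod gens)).
    have -> : s - s' = iota c * g + s - (iota c * g + s').
      by rewrite opprD addrACA subrr add0r.
    by apply: (ksubmodB (kI n)) => //; exact: (ascending_mono incI N1n).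
  have -> : iota c * g + s = iota c * g + s' + (s - s').
    by rewrite -addrA (addrC s') subrK.
  have [_ ID _] := kI (maxn N1 N2).
  by apply: ID; [apply: (ascending_mono incI (leq_maxl _ _)) |
                 apply: (ascending_mono incI (leq_maxr _ _))].
have [I0 ID IZ] := kI n.
split=> [|c d [s [hs Is]] [t [ht It]]|c d [s [hs Is]]].
- by exists 0; rewrite rmorph0 mul0r addr0.
- exists (s + t); split; first exact: kSD.
  by rewrite rmorphD mulrDl addrACA; exact: ID.
exists (iota c * s); split; first exact: kSZ.
by rewrite rmorphM -mulrA -mulrDr; exact: IZ.
Qed.

Lemma noetherian_ksubmod : noetherian k -> kmod_fin_gen iota ->
  ascending_stable (ksubmod iota).
Proof.
move=> acc [gens spanS] I kI incI.
have [N stab] := noetherian_kspan acc gens kI incI.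
by exists N => n x Nn; apply: stab => //; exact: spanS.
Qed.

Lemma ideal_ksubmod (I : S -> Prop) : is_ideal I -> ksubmod iota I.
Proof. by case=> I0 ID IM; split=> // c x; exact: IM. Qed.

Lemma kspan_sub (gens gens' : seq S) r :
  (forall g, g \in gens -> kspan gens' g) -> kspan gens r -> kspan gens' r.
Proof.
have kS := kspan_ksubmod gens'; move=> sub [cs [_ ->]].
by apply: (ksubmod_sum _ kS) => i _; case: kS => _ _; apply; exact/sub/mem_nth.
Qed.

(** The spans of 1, x, ..., x^(n-1) form an ascending chain; where it stops, a power of x is a
    combination of lower ones. *)
Lemma ascending_integral : ascending_stable (ksubmod iota) ->
  forall x : S, exists (d : nat) (a : nat -> k),
    x ^+ d + \sum_(i < d) iota (a i) * x ^+ i = 0.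
Proof.
move=> acc x; pose I n := kspan (mkseq (fun i => x ^+ i) n).
have [n|n y|N stab] := acc I; first exact: kspan_ksubmod.
  apply: kspan_sub => _ /mapP[i + ->]; rewrite mem_iota => /andP[_ ltin].
  by apply/kspan_mem/map_f; rewrite mem_iota; exact: leqW.
have [|cs [_ eqx]] := stab N.+1 (x ^+ N) (leqnSn N).
  by apply/kspan_mem/map_f; rewrite mem_iota /= leqnn.
exists N, (fun i => - nth 0 cs i); rewrite {1}eqx size_mkseq -big_split big1 //= => i _.
by rewrite nth_mkseq // rmorphN mulNr subrr.
Qed.
End FinGen.

(** * Automorphisms close to the identity *)

(** Substitute, in the presence of zero divisors, for the bound on the number of roots of a monic
    polynomial. The coefficient vector annihilates the Vandermonde matrix of d + 1 roots;
    multiplying by the adjugate leaves the determinant times this vector, whose last entry is 1. *)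
Lemma Vandermonde_roots (S : comPzRingType) (d : nat) (a y : nat -> S) :
  (forall j, (j <= d)%N -> y j ^+ d + \sum_(i < d) a i * y j ^+ i = 0) ->
  \prod_(i < d.+1) \prod_(j < d.+1 | (i < j)%N) (y j - y i) = 0.
Proof.
move=> rooty; pose v : 'rV_d.+1 := \row_j y j.
have -> : \prod_(i < d.+1) \prod_(j < d.+1 | (i < j)%N) (y j - y i)
    = \det (Vandermonde d.+1 v).
  by rewrite det_Vandermonde; do 2!apply: eq_bigr => ? _; rewrite !mxE.
pose b : 'rV_d.+1 := \row_i (if (i < d)%N then a i else 1).
have bV : b *m Vandermonde d.+1 v = 0.
  apply/rowP=> j; rewrite !mxE big_ord_recr /= !mxE ltnn mul1r addrC.
  rewrite -[RHS](rooty j (leq_ord j)); congr (_ + _).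
  by apply: eq_bigr => i _; rewrite !mxE /= ltn_ord.
have := congr1 (mulmx^~ (\adj (Vandermonde d.+1 v))) bV.
rewrite mul0mx -mulmxA mul_mx_adj mul_mx_scalar => /rowP/(_ ord_max).
by rewrite !mxE /= ltnn mulr1.
Qed.

Lemma iter_rmorphB (S : comPzRingType) (c : {rmorphism S -> S}) n :
  {morph iter n c : x y / x - y}.
Proof. by elim: n => // n IHn x y; rewrite !iterS IHn rmorphB. Qed.

Lemma iter_rmorphM (S : comPzRingType) (c : {rmorphism S -> S}) n :
  {morph iter n c : x y / x * y}.
Proof. by elim: n => // n IHn x y; rewrite !iterS IHn rmorphM. Qed.

Lemma iter_rmorph0 (S : comPzRingType) (c : {rmorphism S -> S}) n :
  iter n c 0 = 0.
Proof. by elim: n => // n IHn; rewrite iterS IHn rmorph0. Qed.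

(** With D = f - 1, this is ((1 + D)^n - 1) / D expanded in powers of D. *)
Lemma sum_iter_binomial (V : zmodType) (f : {additive V -> V}) n y :
  \sum_(i < n) iter i f y =
  \sum_(j < n) iter j (fun u => f u - u) y *+ 'C(n, j.+1).
Proof.
pose D u := f u - u.
have iterE m : iter m f y = \sum_(j < m.+1) iter j D y *+ 'C(m, j).
  elim: m => [|m IHm]; first by rewrite big_ord1 bin0.
  pose G (a : nat) (b : nat) := iter a D y *+ b.
  have shift : \sum_(j < m.+1) G j 'C(m, j) = y + \sum_(j < m.+1) G j.+1 'C(m, j.+1).
    rewrite big_ord_recl big_ord_recr /= /G (bin_small (ltnSn m)) mulr0n addr0 bin0.
    by congr (_ + _).
  rewrite iterS IHm raddf_sum.
  under eq_bigr => i _ do rewrite raddfMn -[f _](subrK (iter i D y)) mulrnDl.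
  rewrite big_split /= [X in _ + X]shift addrCA [RHS]big_ord_recl bin0 /=.
  by congr (_ + _); rewrite -big_split; apply: eq_bigr => i _; rewrite binS mulrnDr [RHS]addrC.
elim: n => [|n IHn]; first by rewrite !big_ord0.
rewrite big_ord_recr /= IHn iterE.
rewrite [RHS](eq_bigr (fun j : 'I_n.+1 => iter j D y *+ 'C(n, j.+1)
   + iter j D y *+ 'C(n, j))); last by move=> i _; rewrite binS mulrnDr.
by rewrite big_split /= [X in _ = X + _]big_ord_recr /= (bin_small (ltnSn n)) mulr0n addr0.
Qed.

(** * Elements with prime annihilator in a reduced noetherian ring *)

Section PrimeAnnihilator.
Variable S : comPzRingType.
Hypothesis redS : reduced S.
Hypothesis accS : ascending_stable (@is_ideal S).

Lemma reduced_mul (x y : S) : x * (x * y) = 0 -> x * y = 0.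
Proof.
move=> xxy; apply: (@redS _ 2).
have -> : (x * y) ^+ 2 = x * (x * y) * y by ring.
by rewrite xxy mul0r.
Qed.

Definition prime_ann (w : S) : Prop :=
  w <> 0 /\ forall r t, r * t * w = 0 -> r * w = 0 \/ t * w = 0.

Lemma prime_ann_prod w (T : Type) (s : seq T) (P : pred T) (f : T -> S) :
  prime_ann w -> (\prod_(i <- s | P i) f i) * w = 0 ->
  exists2 i, P i & f i * w = 0.
Proof.
case=> w0 prw; elim: s => [|i s IH]; first by rewrite big_nil mul1r.
rewrite big_cons; case Pi: (P i) => //.
by move=> /prw[fi|/IH//]; exists i.
Qed.

(** An annihilator that is maximal among those of the nonzero multiples of z is prime. Since w is
    itself a multiple of z, reducedness keeps z w nonzero. *)
Lemma exists_prime_ann z : z <> 0 -> exists w, z * w <> 0 /\ prime_ann w.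
Proof.
move=> z0; pose F A := exists2 a, z * a <> 0 & A = (fun r => r * (z * a) = 0).
have [||_ [a za0 ->] maxa] := @ascending_stable_maximal _ F.
- apply: ascending_stable_sub accS => _ [a _ ->]; split=> [|x y|c x].
  + by rewrite mul0r.
  + by rewrite mulrDl => -> ->; rewrite addr0.
  + by rewrite -mulrA => ->; rewrite mulr0.
- by exists (fun r => r * (z * 1) = 0); exists 1 => //; rewrite mulr1.
exists (z * a); split; first by move/reduced_mul.
split=> // r t rtza; have [rza|rza] := pselect (r * (z * a) = 0); [by left|right].
have zra : z * (r * a) <> 0 by rewrite mulrCA.
have Fra : F (fun x => x * (z * (r * a)) = 0) by exists (r * a).
apply: (maxa _ Fra) => [x xza|].
  by rewrite (mulrCA z) (mulrCA x) xza mulr0.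
by rewrite (mulrCA z) (mulrA t r) (mulrC t r).
Qed.

Variables c c' : {rmorphism S -> S}.
Hypotheses (cK : cancel c c') (c'K : cancel c' c).

(* If the annihilators of the c^i w were pairwise distinct, all the products
   c^i w * c^j w would vanish, and the ideals (w, ..., c^n w) would grow forever. *)
Lemma prime_ann_periodic w : prime_ann w ->
  exists2 m, (0 < m)%N & forall r, r * iter m c w = 0 <-> r * w = 0.
Proof.
move=> [w0 prw]; pose J n r := exists b : nat -> S, r = \sum_(i < n) b i * iter i c w.
have iterK n : cancel (iter n c) (iter n c').
  by elim: n => // n IH x; rewrite (iterS n c) iterSr cK IH.
have iterK' n : cancel (iter n c') (iter n c).
  by elim: n => // n IH x; rewrite (iterS n c') iterSr c'K IH.
have iter_prw n r t : r * t * iter n c w = 0 ->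
    r * iter n c w = 0 \/ t * iter n c w = 0.
  move=> /(congr1 (iter n c')); rewrite !iter_rmorphM iterK iter_rmorph0.
  by case/prw=> /(congr1 (iter n c)); rewrite iter_rmorph0 iter_rmorphM iterK';
    [left|right].
have [n|n r [b ->]|N stab] := accS (I := J).
- split=> [|x y [a ->] [b ->]|x y [b ->]].
  + by exists (fun=> 0); rewrite big1 // => i _; rewrite mul0r.
  + exists (fun i => a i + b i); rewrite -big_split.
    by apply: eq_bigr => i _; rewrite mulrDl.
  + exists (fun i => x * b i); rewrite mulr_sumr.
    by apply: eq_bigr => i _; rewrite mulrA.
- exists (fun i => if (i < n)%N then b i else 0).
  rewrite big_ord_recr /= ltnn mul0r addr0.
  by apply: eq_bigr => i _; rewrite ltn_ord.
have [|b eqwN] := stab N.+1 (iter N c w) (leqnSn N).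
  exists (fun i => (i == N)%:R); rewrite big_ord_recr /= eqxx mul1r big1 ?add0r //.
  by move=> i _; rewrite ltn_eqF ?mul0r.
have iterw0 n : iter n c w <> 0.
  by move=> /(congr1 (iter n c')); rewrite iterK iter_rmorph0.
(* Otherwise c^N w, a combination of the c^i w with i < N, would be killed by all of them and have
   square zero. *)
have [i ltiN wiN] : exists2 i, (i < N)%N & iter i c w * iter N c w <> 0.
  apply: contrapT => noi; apply: (iterw0 N); apply: (@redS _ 2).
  rewrite expr2 {1}eqwN mulr_suml big1 // => i _; rewrite -mulrA.
  have [->|wiN] := pselect (iter i c w * iter N c w = 0); first by rewrite mulr0.
  by case: noi; exists i.
exists (N - i)%N; first by rewrite subn_gt0.
(* Since the product of c^i w and c^N w is not zero, each of the two prime annihilators contains the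
   other. *)
have eq_ann r : r * iter N c w = 0 <-> r * iter i c w = 0.
  split=> r0.
    have /iter_prw[//|] : r * iter N c w * iter i c w = 0 by rewrite r0 mul0r.
    by rewrite mulrC.
  have /iter_prw[//|//] : r * iter i c w * iter N c w = 0 by rewrite r0 mul0r.
have {eq_ann} := eq_ann (iter i c _); rewrite -{1}(subnK (ltnW ltiN)) addnC iterD.
move=> eq_ann r; have := eq_ann r; rewrite -!iter_rmorphM.
have it0 x : iter i c x = 0 <-> x = 0.
  by split=> [/(congr1 (iter i c'))|->]; rewrite iter_rmorph0 ?iterK.
by rewrite !it0.
Qed.

(** All c^(m j) y are roots of one polynomial, as c fixes its coefficients. Modulo the prime
    annihilator of c^i w, two of the first d + 1 of them agree, which gives y a period there. All i
    are treated at once because the annihilator of the whole orbit of w is needed as a c-stable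
    ideal. *)
Lemma orbit_ann_periodic w y (d : nat) (a : nat -> S) :
  prime_ann w -> (forall i, c (a i) = a i) ->
  y ^+ d + \sum_(i < d) a i * y ^+ i = 0 ->
  exists2 m, (0 < m)%N & forall i, (iter m c y - y) * iter i c w = 0.
Proof.
move=> prw ca fy; have [m m_gt0 annm] := prime_ann_periodic prw.
have iterK n : cancel (iter n c) (iter n c').
  by elim: n => // n IH x; rewrite (iterS n c) iterSr cK IH.
have iterK' n : cancel (iter n c') (iter n c).
  by elim: n => // n IH x; rewrite (iterS n c') iterSr c'K IH.
have it0 n x : iter n c x = 0 <-> x = 0.
  by split=> [/(congr1 (iter n c'))|->]; rewrite iter_rmorph0 ?iterK.
(* The period found at index i is m times some e <= d depending on i; d! is a common multiple of all
   such e. *)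
exists (m * d`!)%N => [|i]; first by rewrite muln_gt0 m_gt0 fact_gt0.
pose wi := iter i c w.
have prwi : prime_ann wi.
  case: prw => w0 prw; split=> [/it0//|r t].
  by rewrite /wi -[r](iterK' i) -[t](iterK' i) -!iter_rmorphM !it0 iter_rmorphM; exact: prw.
have annwi q r : r * iter (m * q) c wi = 0 <-> r * wi = 0.
  rewrite /wi -iterD addnC iterD -[r](iterK' i) -!iter_rmorphM !it0.
  elim: q (iter i c' r) => [|q IHq] t; first by rewrite muln0.
  rewrite mulnS iterD -{1}[t](iterK' m) -!iter_rmorphM it0 IHq.
  by rewrite -(it0 m) iter_rmorphM iterK'.
have stab q r : iter (m * q) c r * wi = 0 <-> r * wi = 0.
  by rewrite -(annwi q) -iter_rmorphM it0.
have fiter n : iter n c y ^+ d + \sum_(l < d) a l * iter n c y ^+ l = 0.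
  elim: n => // n /(congr1 c); rewrite rmorph0 => IHn; rewrite -[RHS]IHn.
  rewrite rmorphD rmorphXn rmorph_sum; congr (_ + _).
  by apply: eq_bigr => l _; rewrite rmorphM rmorphXn ca.
have /(congr1 ( *%R^~ wi)) :=
  @Vandermonde_roots S d a (fun j => iter (m * j) c y) (fun j _ => fiter _).
rewrite mul0r => /(prime_ann_prod prwi)[j _].
move=> /(prime_ann_prod prwi)[l ltjl]; rewrite /= -(subnK (ltnW ltjl)) addnC mulnDr.
rewrite iterD -iter_rmorphB => /stab; set e := (l - j)%N => per_e.
have /dvdnP[q ->] : (e %| d`!)%N.
  by rewrite dvdn_fact // subn_gt0 ltjl (leq_trans (leq_subr _ _)) ?leq_ord.
elim: q => [|q IHq]; first by rewrite mul0n muln0 subrr mul0r.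
rewrite mulSn mulnDr iterD -[iter (m * e) c _](subrK (iter (m * e) c y)).
by rewrite -iter_rmorphB -addrA mulrDl per_e addr0; exact/stab.
Qed.
End PrimeAnnihilator.

Definition nat_regular (S : comPzRingType) (p : nat) : Prop :=
  forall x : S, p%:R * x = 0 -> x = 0.

Definition p_separated (S : comPzRingType) (p : nat) : Prop :=
  forall x : S, (forall n, exists y : S, x = (p ^ n)%:R * y) -> x = 0.

(** * Rigidity of automorphisms congruent to the identity *)

Section Rigidity.
Variables (S : comPzRingType) (L : S -> Prop).
Hypotheses (LD : forall x y, L x -> L y -> L (x + y))
  (LN : forall x, L x -> L (- x)).

Lemma closed_mulrn x n : L x -> L (x *+ n).
Proof.
move=> Lx; case: n => [|n]; first by rewrite mulr0n -(subrr x); exact/LD/LN.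
by elim: n => // n IHn; rewrite mulrS; exact: LD.
Qed.

(* Models pi = zeta - 1 for a primitive p-th root of unity zeta: p is, up to a unit of
   Z[zeta], the power pi^(p-1). *)
Definition uniformizer (p : nat) (pi : S) : Prop :=
  [/\ prime p, (forall x, L x -> L (pi * x)),
      (exists2 u, pi ^+ p.-1 = p%:R * u & forall x, L x -> L (u * x)) &
      (exists2 u, p%:R = pi * u & forall x, L x -> L (u * x))].

(** The quotient v is required in L, not merely in S, so that the congruence applies to v again. *)
Definition congruent_id (q : S) (f : S -> S) : Prop :=
  forall y, L y -> exists2 v, L v & f y = y + q * v.

(** What is needed to remove the prime l from the exponent of f: the auxiliary prime p may depend on
    l, and the double factor pi is demanded only when p = l. *)
Definition rigid_at (l : nat) (f : S -> S) : Prop :=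
  exists p pi, [/\ uniformizer p pi, f pi = pi,
     nat_regular S p, p_separated S p &
     congruent_id pi f /\ (l <> p \/ congruent_id (pi ^+ 2) f)].

Lemma congruent_id_iter q (f : {rmorphism S -> S}) n :
  (forall x, L x -> L (q * x)) -> f q = q ->
  congruent_id q f -> congruent_id q (iter n f).
Proof.
move=> Lq fq cf y Ly; elim: n => [|n [v Lv IHn]].
  by exists 0; [rewrite -(subrr y); exact/LD/LN | rewrite mulr0 addr0].
have [v1 Lv1 fy] := cf y Ly; have [v2 Lv2 fv] := cf v Lv.
exists (v1 + (v + q * v2)); first by apply: LD => //; apply: LD => //; exact: Lq.
by rewrite iterS IHn rmorphD rmorphM fq fv fy -addrA -mulrDr.
Qed.

Lemma rigid_at_iter l (f : {rmorphism S -> S}) n :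
  rigid_at l f -> rigid_at l (iter n f).
Proof.
case=> p [pi [upi fpi regp sepp [cf cf2]]].
have [_ Lpi _ _] := upi.
have itpi : iter n f pi = pi by elim: n => // n IHn; rewrite iterS IHn.
exists p, pi; split=> //; split; first exact: congruent_id_iter.
case: cf2 => [|cf2]; [by left | right; apply: congruent_id_iter => //].
  by move=> x Lx; rewrite expr2 -mulrA; exact/Lpi/Lpi.
by rewrite rmorphXn fpi.
Qed.

Section Step.
Variables (Q : S -> Prop) (f : {rmorphism S -> S}).
Hypotheses (QD : forall x y, Q x -> Q y -> Q (x + y)) (QM : forall r x, Q x -> Q (r * x)).
Hypothesis Qf : forall x, Q x -> Q (f x).
Hypothesis Qreg : forall p, nat_regular S p -> forall x, Q (p%:R * x) -> Q x.
Hypothesis Qsep : forall p x, p_separated S p ->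
  (forall n, exists y : S, Q (x - (p ^ n)%:R * y)) -> Q x.

Hypothesis Q0 : Q 0.
Let QN x : Q x -> Q (- x).
Proof. by rewrite -mulN1r; exact: QM. Qed.

(* The sum is l y modulo pi, and p y modulo p pi when l = p. *)
Lemma trace_divisible l y p pi :
  prime l -> uniformizer p pi -> nat_regular S p -> f pi = pi ->
  congruent_id pi f /\ (l <> p \/ congruent_id (pi ^+ 2) f) ->
  L y -> Q (\sum_(i < l) iter i f y) -> exists2 v, L v & Q (y - pi * v).
Proof.
move=> l_pr [p_pr Lpi [u1 piE Lu1] [u2 pE Lu2]] regp fpi [cf].
have L0 : L y -> L 0 by move=> Ly; rewrite -(subrr y); exact/LD/LN.
have [->{l l_pr} [] // cf2 | /eqP neqlp _] := eqVneq l p.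
  move=> Ly; rewrite sum_iter_binomial.
  pose D u := f u - u.
  have itD j : exists2 v, L v & iter j D y = (pi ^+ 2) ^+ j * v.
    elim: j => [|j [v Lv IHj]]; first by exists y; rewrite ?expr0 ?mul1r.
    have [v2 Lv2 fv] := cf2 v Lv; exists v2 => //.
    by rewrite iterS IHj /D rmorphM !rmorphXn fpi fv mulrDr addrAC subrr add0r mulrA -exprSr.
  have p_gt0 := prime_gt0 p_pr; have p_gt1 := prime_gt1 p_pr.
  (* Each application of D yields pi^2, so every term after the first is divisible by p pi. *)
  have {itD} termE j : (0 < j < p)%N ->
      exists2 v, L v & iter j D y *+ 'C(p, j.+1) = p%:R * (pi * v).
    case: j => // j ltjp; have [v Lv ->] := itD j.+1.
    have LpiX n x : L x -> L (pi ^+ n * x).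
      by elim: n => [|n IHn] Lx; rewrite ?expr0 ?mul1r // exprS -mulrA; apply/Lpi/IHn.
    have [ltj|] := ltnP j.+2 p.
      have /dvdnP[q ->] : (p %| 'C(p, j.+2))%N by rewrite prime_dvd_bin.
      exists ((pi ^+ (j.*2.+1) * v) *+ q); first exact/closed_mulrn/LpiX.
      rewrite mulrnA -[LHS]mulr_natl; congr (_ * _).
      by rewrite mulrnAr mulrA -exprS -exprM mul2n doubleS.
    (* The last binomial coefficient is 1. Here the power of pi is 2 (p - 1): one half of it
       supplies p, the other half still contains pi. *)
    move=> lepj; have {lepj ltjp} pE' : p = j.+2 by apply/eqP; rewrite eqn_leq lepj.
    exists (pi ^+ j * (u1 * v)); first exact/LpiX/Lu1.
    have piE2 : pi ^+ j.+1 = p%:R * u1 by rewrite -piE pE'.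
    rewrite -{1}pE' binn mulr1n -exprM mulnC exprM expr2 {1}piE2 exprS.
    by rewrite -!mulrA; congr (_ * _); rewrite mulrCA; congr (_ * _); rewrite mulrCA.
  rewrite (bigD1 (Ordinal p_gt0)) //= bin1.
  have [v Lv ->] : exists2 v, L v &
      \sum_(i < p | i != Ordinal p_gt0) iter i D y *+ 'C(p, i.+1) = p%:R * (pi * v).
    elim/big_rec: _ => [|i x neqi0 [v Lv ->]].
      by exists 0; [exact: L0 | rewrite !mulr0].
    have [|v1 Lv1 ->] := termE i; first by rewrite ltn_ord andbT lt0n.
    by exists (v1 + v); [exact: LD | rewrite !mulrDr].
  rewrite -[y *+ p]mulr_natl -mulrDr => /(Qreg regp) Qy.
  by exists (- v); [exact: LN | rewrite mulrN opprK].
move=> Ly; have [v Lv ->] : exists2 v, L v & \sum_(i < l) iter i f y = l%:R * y + pi * v.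
  elim: l {l_pr neqlp} => [|l [v Lv IHl]].
    by exists 0; [exact: L0 | rewrite big_ord0 mul0r mulr0 addr0].
  have [v1 Lv1 fy] := congruent_id_iter l Lpi fpi cf Ly.
  exists (v + v1); first exact: LD.
  by rewrite big_ord_recr /= IHl fy -addn1 natrD mulrDl mul1r mulrDr addrACA.
(* Bezout gives a l = b p + 1, and p = pi u2, so a times the trace is y modulo pi. *)
have [a b ab _] := @egcdnP l p (prime_gt0 l_pr).
have {}ab : (a * l = b * p + 1)%N.
  rewrite ab; congr (_ + _)%N; apply/eqP.
  by rewrite -/(coprime l p) prime_coprime // dvdn_prime2 //; apply/eqP.
move=> /(QM a%:R) Qa; exists (- (a%:R * v + b%:R * (u2 * y))).
  by apply/LN/LD; rewrite mulr_natl; apply: closed_mulrn => //; exact: Lu2.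
rewrite mulrN opprK; move: Qa; congr Q.
rewrite mulrDr mulrA -natrM ab natrD natrM mulrDl mul1r pE [in RHS]mulrDr.
rewrite (addrC _ y) -addrA; congr (y + _); rewrite addrC.
by congr (_ + _); [exact: mulrCA | rewrite -mulrA -mulrA mulrCA].
Qed.

(** The trace of z = f y - y telescopes to f^l y - y, which lies in Q. If z is pi^s t modulo Q,
    cancelling pi^s shows that t has trace in Q, and [trace_divisible] extracts one more factor pi.
    So z is divisible modulo Q by all powers of pi, hence of p. *)
Lemma rigid_step l y : prime l -> rigid_at l f -> L y ->
  Q (iter l f y - y) -> Q (f y - y).
Proof.
move=> l_pr [p [pi [upi fpi regp sepp cf]]] Ly Qly.
have [p_pr Lpi [u1 piE _] [u2 pE _]] := upi.
have [v Lv fy] := cf.1 y Ly.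
have Lz : L (f y - y) by rewrite fy addrC addKr; exact: Lpi.
have Lf x : L x -> L (f x).
  by move=> /[dup] Lx /cf.1[w Lw ->]; apply/LD/Lpi.
have pireg x : Q (pi * x) -> Q x.
  by move=> /(QM u2); rewrite mulrA (mulrC u2) -pE; exact: Qreg.
have piXreg s x : Q (pi ^+ s * x) -> Q x.
  by elim: s => [|s IHs]; rewrite ?expr0 ?mul1r // exprS -mulrA => /pireg/IHs.
have divz s : exists2 t, L t & Q (f y - y - pi ^+ s * t).
  elim: s => [|s [t Lt Qt]].
    by exists (f y - y) => //; rewrite expr0 mul1r subrr.
  have Qtr : Q (\sum_(i < l) iter i f t).
    apply: (piXreg s); rewrite mulr_sumr.
    have -> : \sum_(i < l) pi ^+ s * iter i f t =
      iter l f y - y - \sum_(i < l) iter i f (f y - y - pi ^+ s * t).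
      elim: (l) => [|n IHn]; first by rewrite !big_ord0 !subrr.
      rewrite !big_ord_recr /= IHn iter_rmorphB iter_rmorphM iter_rmorphB -iterSr iterS.
      have -> : iter n f (pi ^+ s) = pi ^+ s.
        by elim: (n) => // j IHj; rewrite iterS IHj rmorphXn fpi.
      by ring.
    apply: QD => //; apply: QN; elim/big_rec: _ => // i x _ Qx; apply: QD => //.
    by elim: (i : nat) => // j IHj; rewrite iterS; exact: Qf.
  have [w Lw Qw] := trace_divisible l_pr upi regp fpi cf Lt Qtr.
  exists w => //; have -> : f y - y - pi ^+ s.+1 * w =
      (f y - y - pi ^+ s * t) + pi ^+ s * (t - pi * w).
    by rewrite mulrBr addrA subrK exprSr -mulrA.
  by apply: QD => //; exact: QM.
(* As pi^(p-1) = p u1, a supply of (p - 1) n factors pi contains n factors p. *)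
apply: (Qsep sepp) => n; have [t _ Qt] := divz (p.-1 * n)%N.
by exists (u1 ^+ n * t); rewrite mulrA natrX -exprMn -piE -exprM.
Qed.
End Step.

Fixpoint rmorph_iter (f : {rmorphism S -> S}) n : {rmorphism S -> S} :=
  if n is n'.+1 then f \o rmorph_iter f n' else idfun.

Lemma rmorph_iterE (f : {rmorphism S -> S}) n : rmorph_iter f n =1 iter n f.
Proof. by elim: n => // n IHn x; rewrite iterS /= IHn. Qed.

(** One prime l of m = q l is removed at a time, by applying [rigid_step] to f^q, which is as rigid
    as f. *)
Lemma rigid_descent (Q : S -> Prop) (f : {rmorphism S -> S}) m y :
  Q 0 -> (forall x y, Q x -> Q y -> Q (x + y)) -> (forall r x, Q x -> Q (r * x)) ->
  (forall x, Q x -> Q (f x)) ->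
  (forall p, nat_regular S p -> forall x, Q (p%:R * x) -> Q x) ->
  (forall p x, p_separated S p ->
     (forall n, exists y : S, Q (x - (p ^ n)%:R * y)) -> Q x) ->
  (forall l, prime l -> rigid_at l f) -> L y -> (0 < m)%N ->
  Q (iter m f y - y) -> Q (f y - y).
Proof.
move=> Q0 QD QM Qf Qreg Qsep rigf Ly; have [n] := ubnP m.
elim: n m => // n IHn m /ltnSE lemn m_gt0 Qm.
have [m1|m_gt1] := leqP m 1.
  by move: Qm; have -> : m = 1%N by apply/eqP; rewrite eqn_leq m1.
have l_pr := pdiv_prime m_gt1; have /dvdnP[q mE] := pdiv_dvd m.
have q_gt0 : (0 < q)%N by move: m_gt0; rewrite mE muln_gt0; case/andP.
apply: (IHn q) => //.
  by apply: leq_trans lemn; rewrite mE ltn_Pmulr // prime_gt1.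
rewrite -rmorph_iterE; apply: (rigid_step QD QM _ Qreg Qsep Q0 l_pr) => //.
- move=> x Qx; rewrite rmorph_iterE.
  by elim: (q) => // j IHj; rewrite iterS; exact: Qf.
- have [p [pi [upi fpi regp sepp cf]]] := rigid_at_iter q (rigf _ l_pr).
  exists p, pi; split=> //; first by rewrite rmorph_iterE.
  split; first by move=> x Lx; rewrite rmorph_iterE; exact: cf.1.
  by case: cf.2 => [|cf2]; [left | right => x Lx; rewrite rmorph_iterE; exact: cf2].
by rewrite (eq_iter (rmorph_iterE f q)) -iterM mulnC -mE.
Qed.

Theorem rigid_automorphism (c c' : {rmorphism S -> S}) y (d : nat) (a : nat -> S) :
  reduced S -> ascending_stable (@is_ideal S) -> cancel c c' -> cancel c' c ->
  (forall l, prime l -> rigid_at l c) -> L y ->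
  (forall i, c (a i) = a i) -> y ^+ d + \sum_(i < d) a i * y ^+ i = 0 ->
  c y = y.
Proof.
move=> redS accS cK c'K rigc Ly ca fy; apply/eqP; rewrite -subr_eq0; apply/eqP.
apply: contrapT => /(exists_prime_ann redS accS)[w [zw prw]]; apply: zw.
have [m m_gt0 annm] := prime_ann_periodic redS accS cK c'K prw.
have [M M_gt0 perM] := orbit_ann_periodic redS accS cK c'K prw ca fy.
(* The annihilator of the orbit of w. It inherits regularity and separatedness of p, which an
   arbitrary ideal would not: multiplying by c^i w brings the question back to S. *)
pose Q r := forall i, r * iter i c w = 0.
suff : Q (c y - y) by move=> /(_ 0%N).
apply: (@rigid_descent Q c M) => //.
- by move=> i; rewrite mul0r.
- by move=> x t Qx Qt i; rewrite mulrDl Qx Qt addr0.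
- by move=> r x Qx i; rewrite -mulrA Qx mulr0.
(* Index 0 has no predecessor; there w is replaced by c^m w, which has the same annihilator. *)
- move=> x Qx [|i]; last by rewrite iterS -rmorphM Qx rmorph0.
  by apply/annm; case: m m_gt0 {annm} => // m _; rewrite iterS -rmorphM Qx rmorph0.
- by move=> p regp x Qx i; apply: regp; rewrite mulrA Qx.
- move=> p x sepp Qx i; apply: sepp => n; have [t /(_ i)] := Qx n.
  by move=> /eqP; rewrite mulrBl subr_eq0 => /eqP->; exists (t * iter i c w); rewrite mulrA.
Qed.
End Rigidity.

(** * Gradings by finite cyclic groups *)

Section CyclicGradings.
Variables (S : comPzRingType) (K : S -> Prop).

(* P a is the projection onto the component of degree a; only a < n is meaningful. *)
Record cyclic_grading (n : nat) (P : nat -> S -> S) : Prop := CyclicGrading {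
  cycD : forall a x y, P a (x + y) = P a x + P a y;
  cycK : forall a c x, K c -> P a (c * x) = c * P a x;
  cyc_orth : forall a b x, (a < n)%N -> (b < n)%N ->
    P a (P b x) = if a == b then P b x else 0;
  cyc_sum : forall x, \sum_(a < n) P a x = x;
  cyc1 : P 0%N 1 = 1;
  cycM : forall a b x y, (a < n)%N -> (b < n)%N ->
    P ((a + b) %% n)%N (P a x * P b y) = P a x * P b y }.

Hypotheses (K1 : K 1) (KD : forall x y, K x -> K y -> K (x + y))
  (KN : forall x, K x -> K (- x)) (KM : forall x y, K x -> K y -> K (x * y)).

Let K0 : K 0. Proof. by rewrite -(subrr 1); exact/KD/KN. Qed.

Let KX x n : K x -> K (x ^+ n).
Proof. by move=> Kx; elim: n => // n IHn; rewrite exprS; exact: KM. Qed.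

Let K_sum (I : Type) (s : seq I) (R : pred I) (x : I -> S) :
  (forall i, R i -> K (x i)) -> K (\sum_(i <- s | R i) x i).
Proof. by move=> Kx; elim/big_rec: _ => // i y Ri; exact/KD/Kx. Qed.

Let K_muln x n : K x -> K (x *+ n).
Proof. by move=> Kx; elim: n => // n IHn; rewrite mulrS; exact: KD. Qed.

Section OneGrading.
Variables (n : nat) (P : nat -> S -> S).
Hypotheses (n_gt0 : (0 < n)%N) (cycP : cyclic_grading n P).

Lemma cyc0 a : P a 0 = 0.
Proof. by rewrite -{1}(mul0r 0) (cycK cycP) // mul0r. Qed.

Lemma cyc_big a (I : Type) (s : seq I) (R : pred I) (x : I -> S) :
  P a (\sum_(i <- s | R i) x i) = \sum_(i <- s | R i) P a (x i).
Proof.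
by elim/big_rec2: _ => [|i y1 y2 _ <-]; rewrite ?cyc0 ?(cycD cycP).
Qed.

Lemma cyc_homog a b x : (a < n)%N -> (b < n)%N -> P b x = x ->
  P a x = if a == b then x else 0.
Proof. by move=> an bn <-; rewrite (cyc_orth cycP). Qed.

(** The action on a Z/n-graded ring of the character a -> xi^a. *)
Definition twist (xi : S) (x : S) : S := \sum_(a < n) xi ^+ a * P a x.

Lemma twist_homog xi b x : (b < n)%N -> P b x = x -> twist xi x = xi ^+ b * x.
Proof.
move=> bn Pbx; rewrite /twist (bigD1 (Ordinal bn)) //= Pbx big1 ?addr0 // => a neqab.
by rewrite (cyc_homog _ bn) // (negPf (neqab : (a : nat) != b)) mulr0.
Qed.

Lemma twistD xi x y : twist xi (x + y) = twist xi x + twist xi y.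
Proof. by rewrite -big_split; apply: eq_bigr => a _; rewrite (cycD cycP) mulrDr. Qed.

Lemma twistK xi c x : K c -> twist xi (c * x) = c * twist xi x.
Proof.
by move=> Kc; rewrite mulr_sumr; apply: eq_bigr => a _; rewrite (cycK cycP) // mulrCA.
Qed.

Lemma twist_sum xi (I : Type) (s : seq I) (R : pred I) (x : I -> S) :
  twist xi (\sum_(i <- s | R i) x i) = \sum_(i <- s | R i) twist xi (x i).
Proof.
elim/big_rec2: _ => [|i y1 y2 _ <-]; rewrite ?twistD //.
by rewrite /twist big1 // => a _; rewrite cyc0 mulr0.
Qed.

Lemma cyc_proj a x : (a < n)%N -> P a (P a x) = P a x.
Proof. by move=> an; rewrite (cyc_orth cycP) // eqxx. Qed.

Lemma twist_comp xi xi' x : K xi' -> xi ^+ n = 1 -> xi * xi' = 1 ->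
  twist xi (twist xi' x) = x.
Proof.
move=> Kxi' xin xixi'; rewrite [twist xi' x]/twist twist_sum.
rewrite -[RHS](cyc_sum cycP); apply: eq_bigr => a _.
rewrite twistK; last exact: KX.
by rewrite (twist_homog _ (ltn_ord a)) ?cyc_proj // mulrA -exprMn mulrC (mulrC xi') xixi' expr1n mulr1.
Qed.

Lemma twist1 xi : twist xi 1 = 1.
Proof. by rewrite (twist_homog _ n_gt0) ?(cyc1 cycP) // expr0 mul1r. Qed.

(** Degrees add only modulo n, so multiplicativity rests on xi^n = 1. *)
Lemma twist_rmorphism xi : xi ^+ n = 1 ->
  exists f : {rmorphism S -> S}, f =1 twist xi.
Proof.
move=> xin.
have zm : zmod_morphism (twist xi).
  by move=> x y; rewrite twistD -mulN1r twistK ?mulN1r //; exact: KN.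
have mm : monoid_morphism (twist xi).
  split=> [|x y]; first exact: twist1.
  rewrite -{1}(cyc_sum cycP x) -{1}(cyc_sum cycP y) mulr_suml twist_sum.
  rewrite {2}/twist mulr_suml; apply: eq_bigr => a _.
  rewrite mulr_sumr twist_sum /twist mulr_sumr; apply: eq_bigr => b _.
  rewrite -/(twist _ _) (twist_homog _ _ (cycM cycP _ _ _ _)) ?ltn_pmod //.
  by rewrite !(expr_mod _ xin) mulrACA -exprD.
pose f1 := GRing.isZmodMorphism.Build S S (twist xi) zm.
pose f2 := GRing.isMonoidMorphism.Build S S (twist xi) mm.
pose f : {rmorphism S -> S} := HB.pack (twist xi) f1 f2.
by exists f.
Qed.

(** For M dividing n, the projection to degree b of the grading induced along Z/n -> Z/M. *)
Definition coarse (M b : nat) (x : S) : S := \sum_(a < n | (a %% M == b)%N) P a x.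

Lemma coarse_homog M a b x : (b < n)%N -> P b x = x ->
  coarse M a x = if (b %% M == a)%N then x else 0.
Proof.
move=> bn Pbx; rewrite /coarse; case: ifP => [ba|nba].
  rewrite (bigD1 (Ordinal bn)) //= Pbx big1 ?addr0 // => i /andP[_ neqib].
  by rewrite (cyc_homog _ bn) // (negPf (neqib : (i : nat) != b)).
rewrite big1 // => i ia; rewrite (cyc_homog _ bn) //.
by case: (eqVneq (i : nat) b) => // ib; move: ia; rewrite ib nba.
Qed.

Lemma coarseD M a x y : coarse M a (x + y) = coarse M a x + coarse M a y.
Proof. by rewrite -big_split; apply: eq_bigr => i _; rewrite (cycD cycP). Qed.

Lemma coarseK M a c x : K c -> coarse M a (c * x) = c * coarse M a x.
Proof. by move=> Kc; rewrite mulr_sumr; apply: eq_bigr => i _; rewrite (cycK cycP). Qed.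

Lemma coarse_sum M a (I : Type) (s : seq I) (R : pred I) (x : I -> S) :
  coarse M a (\sum_(i <- s | R i) x i) = \sum_(i <- s | R i) coarse M a (x i).
Proof.
elim/big_rec2: _ => [|i y1 y2 _ <-]; rewrite ?coarseD //.
by rewrite /coarse big1 // => i _; rewrite cyc0.
Qed.

Lemma coarse_cyclic M : (M %| n)%N -> cyclic_grading M (coarse M).
Proof.
move=> Mn; have M_gt0 : (0 < M)%N by exact: dvdn_gt0 Mn.
split.
- exact: coarseD.
- exact: coarseK.
- move=> a b x aM bM; rewrite {2}/coarse coarse_sum.
  case: eqP => [->|neqab].
    by apply: eq_bigr => i ib; rewrite (coarse_homog _ _ (ltn_ord i)) ?cyc_proj // ib.
  rewrite big1 // => i /eqP ib; rewrite (coarse_homog _ _ (ltn_ord i)) ?cyc_proj //.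
  by rewrite ib; case: eqP neqab => // ->.
- move=> x; rewrite -[RHS](cyc_sum cycP) [RHS](partition_big (fun i : 'I_n =>
    Ordinal (ltn_pmod i M_gt0)) xpredT) //=.
- by rewrite (coarse_homog _ _ n_gt0) ?(cyc1 cycP) // mod0n.
move=> a b x y aM bM; rewrite {2 4}/coarse mulr_suml coarse_sum; apply: eq_bigr => i /eqP ia.
rewrite mulr_sumr coarse_sum; apply: eq_bigr => j /eqP jb.
rewrite (coarse_homog _ _ _ (cycM cycP _ _ _ _)) ?ltn_pmod //.
by rewrite modn_dvdm // -modnDm ia jb eqxx.
Qed.

End OneGrading.
End CyclicGradings.

(** * Commutation of two cyclic gradings in the presence of roots of unity *)

Section CyclicCommute.
Variables (S : comPzRingType) (K : S -> Prop).
Hypotheses (K1 : K 1) (KD : forall x y, K x -> K y -> K (x + y))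
  (KN : forall x, K x -> K (- x)) (KM : forall x y, K x -> K y -> K (x * y)).

Let K0 : K 0. Proof. by rewrite -(subrr 1); exact/KD/KN. Qed.

Let KX x n : K x -> K (x ^+ n).
Proof. by move=> Kx; elim: n => // n IHn; rewrite exprS; exact: KM. Qed.

Let K_sum (I : Type) (s : seq I) (R : pred I) (x : I -> S) :
  (forall i, R i -> K (x i)) -> K (\sum_(i <- s | R i) x i).
Proof. by move=> Kx; elim/big_rec: _ => // i y Ri; exact/KD/Kx. Qed.

Let K_muln x n : K x -> K (x *+ n).
Proof. by move=> Kx; elim: n => // n IHn; rewrite mulrS; exact: KD. Qed.

Lemma sum_expr_binomial (w : S) p :
  \sum_(i < p) w ^+ i = \sum_(j < p) (w - 1) ^+ j *+ 'C(p, j.+1).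
Proof.
have itE (v : S) i x : iter i ( *%R v) x = v ^+ i * x.
  by elim: i => [|i IHi]; rewrite ?expr0 ?mul1r // iterS IHi exprS mulrA.
have := sum_iter_binomial (w \*o idfun : {additive S -> S}) p 1.
under eq_bigr do rewrite (itE w) mulr1; move=> ->; apply: eq_bigr => j _.
congr (_ *+ _); rewrite -[RHS]mulr1 -itE.
by apply: eq_iter => x; rewrite mulrBl mul1r.
Qed.

(** In terms of pi = w - 1 the relation becomes an Eisenstein equation: leading coefficient 1,
    constant term p, all coefficients between divisible by p. Isolating the leading term expresses
    pi^(p-1) through p; isolating the constant term expresses p through pi. *)
Lemma root_of_unity_uniformizer (L : S -> Prop) p w :
  (forall c x, K c -> L x -> L (c * x)) -> prime p -> K w ->
  \sum_(i < p) w ^+ i = 0 -> uniformizer L p (w - 1).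
Proof.
move=> LK p_pr Kw; rewrite sum_expr_binomial; set pi := w - 1.
have Kpi : K pi by exact/KD/KN.
case: p p_pr => // q q_pr sum0; split=> // [x||].
- exact: LK.
- exists (- \sum_(j < q) pi ^+ j *+ ('C(q.+1, j.+1) %/ q.+1)); last first.
    by move=> x; apply: LK; apply/KN/K_sum => j _; exact/K_muln/KX.
  move: sum0; rewrite big_ord_recr /= binn mulr1n addrC => /eqP.
  rewrite addr_eq0 => /eqP->; rewrite mulrN mulr_sumr; congr (- _).
  apply: eq_bigr => j _; rewrite mulrnAr mulr_natl -mulrnA.
  by congr (_ *+ _); rewrite mulnC divnK // prime_dvd_bin //= ltnS.
exists (- \sum_(j < q) pi ^+ j *+ 'C(q.+1, j.+2)); last first.
  by move=> x; apply: LK; apply/KN/K_sum => j _; exact/K_muln/KX.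
move: sum0; rewrite big_ord_recl /= bin1 => /eqP.
rewrite addr_eq0 => /eqP->; rewrite mulrN mulr_sumr; congr (- _).
by apply: eq_bigr => j _; rewrite exprS mulrnAr.
Qed.

Variables (N : nat) (zeta : S).
Hypotheses (N_gt0 : (0 < N)%N) (Kz : K zeta) (zN : zeta ^+ N = 1).
Hypothesis zsum : forall p, prime p -> (p %| N)%N ->
  \sum_(u < p) (zeta ^+ (N %/ p)) ^+ u = 0.

(** Among zero divisors, the vanishing sums of [zsum] play the part of primitivity. If two powers of
    w with exponents below p agree on x, Bezout shows that w fixes x; as p is a multiple of w - 1,
    then p x = 0. *)
Lemma root_of_unity_inj p x i j : prime p -> (p %| N)%N -> nat_regular S p ->
  (i < p)%N -> (j < p)%N ->
  (zeta ^+ (N %/ p)) ^+ i * x = (zeta ^+ (N %/ p)) ^+ j * x -> i = j \/ x = 0.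
Proof.
move=> p_pr pN regp; set w := zeta ^+ _.
have wp : w ^+ p = 1 by rewrite -exprM divnK.
wlog ltij : i j / (i < j)%N => [hwlog ip jp eqw|ip jp eqw].
  have [ltij|ltji|eqij] := ltngtP i j; [exact: hwlog | | by left].
  by have [->|->] := hwlog j i ltji jp ip (esym eqw); [left | right].
right; pose d := (j - i)%N.
have wd : w ^+ d * x = x.
  have := congr1 ( *%R (w ^+ (p - i))) eqw; rewrite !mulrA -!exprD subnK ?wp; last exact: ltnW.
  rewrite mul1r => eqx; rewrite [RHS]eqx -[j](subnK (ltnW ltij)) addnCA.
  by rewrite subnK ?exprD ?wp ?mulr1 // ltnW.
have wdm m : w ^+ (d * m) * x = x.
  elim: m => [|m IHm]; first by rewrite muln0 expr0 mul1r.
  by rewrite mulnS exprD -mulrA IHm.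
have d_gt0 : (0 < d)%N by rewrite subn_gt0.
have [a b ab _] := @egcdnP d p d_gt0.
have {ab} : (d * a = b * p + 1)%N.
  rewrite mulnC ab; congr (_ + _)%N; apply/eqP; rewrite gcdnC -/(coprime p d) prime_coprime //.
  by rewrite gtnNdvd // (leq_ltn_trans (leq_subr _ _)).
move=> /(congr1 (fun m => w ^+ m * x)); rewrite wdm addn1 exprSr mulnC exprM wp expr1n mul1r.
move=> wx; have [_ _ _ [u pE _]] : uniformizer (fun=> True) p (w - 1).
  by apply: root_of_unity_uniformizer => //; [exact: KX | exact: zsum].
by apply: regp; rewrite pE mulrAC mulrBl mul1r -wx subrr mul0r.
Qed.

Section Leaf.
Variables (M p : nat) (P : nat -> S -> S).
Hypotheses (p_pr : prime p) (MpN : (M * p %| N)%N) (cycP : cyclic_grading K (M * p) P).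
Hypothesis regp : nat_regular S p.
Let xi := zeta ^+ (N %/ (M * p)).
Let w := zeta ^+ (N %/ p).

Let Mp_gt0 : (0 < M * p)%N. Proof. exact: dvdn_gt0 MpN. Qed.
Let M_gt0 : (0 < M)%N. Proof. by move: Mp_gt0; rewrite muln_gt0; case/andP. Qed.

Lemma twist_root_order : xi ^+ (M * p) = 1.
Proof. by rewrite -exprM divnK. Qed.

Let xi_expM : xi ^+ M = w.
Proof.
rewrite -exprM; congr (_ ^+ _); have /dvdnP[q ->] := MpN.
by rewrite mulnK // mulnA mulnK // prime_gt0.
Qed.

Let xi_modn a : xi ^+ a = xi ^+ (a %% M) * w ^+ (a %/ M).
Proof. by rewrite -xi_expM -exprM -exprD addnC mulnC -divn_eq. Qed.

(** The operator A for which the twist is xi^a0 (1 + (w - 1) A) on the piece of degrees congruent to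
    a0 modulo M. On degree a it is (w^(a/M) - 1) / (w - 1), written as a geometric sum. *)
Definition leaf_part (a0 : nat) (y : S) : S :=
  \sum_(a < M * p | (a %% M == a0)%N) (\sum_(l < a %/ M) w ^+ l) * P a y.

Lemma twist_leaf a0 y : coarse (M * p) P M a0 y = y ->
  twist (M * p) P xi y = xi ^+ a0 * (y + (w - 1) * leaf_part a0 y).
Proof.
move=> yL; rewrite -{1}yL /coarse (twist_sum K1 KD KN cycP) -{2}yL /coarse /leaf_part.
rewrite mulr_sumr -big_split mulr_sumr; apply: eq_bigr => a /eqP aa0.
rewrite (twist_homog cycP _ (ltn_ord a)) ?(cyc_proj cycP) // xi_modn aa0 -mulrA.
by congr (_ * _); rewrite mulrA -subrX1 mulrBl mul1r /= addrC subrK.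
Qed.

(** Degrees congruent modulo M have eigenvalues whose ratio is a power of w, so regularity of p
    alone separates them. *)
Lemma twist_eigen a0 a u : (a < M * p)%N -> (a %% M = a0)%N ->
  coarse (M * p) P M a0 u = u -> twist (M * p) P xi u = xi ^+ a * u -> P a u = u.
Proof.
move=> aMp aa0 uL eigu; rewrite -[RHS]uL /coarse (bigD1 (Ordinal aMp)) /=; last by rewrite aa0.
rewrite big1 ?addr0 // => k /andP[/eqP ka0 neqka].
have eqP : xi ^+ k * P k u = xi ^+ a * P k u.
  rewrite -[RHS](cycK cycP) -?eigu; last exact/KX/KX.
  rewrite /twist (cyc_big K1 KD KN cycP) (bigD1 k) //= (cycK cycP); last exact/KX/KX.
  rewrite (cyc_proj cycP) // big1 ?addr0 // => l neqlk.
  rewrite (cycK cycP); last exact/KX/KX.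
  by rewrite (cyc_orth cycP) // eq_sym (negPf (neqlk : (l : nat) != k)) mulr0.
have a0M : (a0 < M)%N by rewrite -aa0 ltn_pmod.
have a0Mp : (a0 <= M * p)%N by rewrite -aa0 (leq_trans (leq_mod _ _)) // ltnW.
move: eqP; rewrite xi_modn ka0 (xi_modn a) aa0 -!mulrA.
(* Cancels xi^a0, which is invertible because xi^(M p) = 1. *)
move=> /(congr1 ( *%R (xi ^+ (M * p - a0)))); rewrite !(mulrA (xi ^+ _) (xi ^+ _)).
rewrite -exprD subnK // twist_root_order !mul1r.
have ltp b : (b < M * p)%N -> (b %/ M < p)%N by rewrite ltn_divLR // mulnC.
case/root_of_unity_inj; rewrite ?ltp //; first by apply: dvdn_trans MpN; exact: dvdn_mull.
move=> eqdiv; case/eqP: neqka; apply/val_inj => /=.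
by rewrite (divn_eq k M) (divn_eq a M) eqdiv ka0 aa0.
Qed.

End Leaf.

Hypotheses (redS : reduced S) (accS : ascending_stable (@is_ideal S)).
Hypothesis regN : forall p, prime p -> (p %| N)%N -> nat_regular S p.
Hypothesis sepN : forall p, prime p -> (p %| N)%N -> p_separated S p.
Hypothesis intS : forall y, exists (d : nat) (a : nat -> S),
  (forall i, K (a i)) /\ y ^+ d + \sum_(i < d) a i * y ^+ i = 0.

Lemma cyc_coarse_comm n P M a b x : cyclic_grading K n P -> (b < n)%N ->
  coarse n P M a (P b x) = P b (coarse n P M a x).
Proof.
move=> cycP bn; rewrite /coarse (cyc_big K1 KD KN cycP); apply: eq_bigr => i _.
by rewrite !(cyc_orth cycP) // eq_sym; case: eqP => // ->.
Qed.

Lemma coarse_commute n P (F : S -> S) M a x :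
  F 0 = 0 -> (forall x y, F (x + y) = F x + F y) ->
  (forall i x, (i < n)%N -> P i (F x) = F (P i x)) ->
  coarse n P M a (F x) = F (coarse n P M a x).
Proof.
move=> F0 FD PF; rewrite /coarse; elim/big_rec2: _ => [//|i y1 y2 _ ->].
by rewrite PF // FD.
Qed.

Section TwoLeaves.
Variables (M p M' p' : nat) (P Q : nat -> S -> S).
Hypotheses (p_pr : prime p) (p'_pr : prime p').
Hypotheses (MpN : (M * p %| N)%N) (MpN' : (M' * p' %| N)%N).
Hypotheses (cycP : cyclic_grading K (M * p) P) (cycQ : cyclic_grading K (M' * p') Q).
Hypothesis commPQ : forall a b x, (a < M)%N -> (b < M' * p')%N ->
  coarse (M * p) P M a (Q b x) = Q b (coarse (M * p) P M a x).
Hypothesis commQP : forall a b x, (a < M * p)%N -> (b < M')%N ->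
  P a (coarse (M' * p') Q M' b x) = coarse (M' * p') Q M' b (P a x).
Variables a0 b0 : nat.
Hypotheses (a0M : (a0 < M)%N) (b0M : (b0 < M')%N).

Let n := (M * p)%N.
Let n' := (M' * p')%N.
Let L y := coarse n P M a0 y = y /\ coarse n' Q M' b0 y = y.
Let xi := zeta ^+ (N %/ n).
Let xi' := zeta ^+ (N %/ n').
Let w := zeta ^+ (N %/ p).
Let w' := zeta ^+ (N %/ p').

Let n_gt0 : (0 < n)%N. Proof. exact: dvdn_gt0 MpN. Qed.
Let n'_gt0 : (0 < n')%N. Proof. exact: dvdn_gt0 MpN'. Qed.
Let pN : (p %| N)%N. Proof. by apply: dvdn_trans MpN; exact: dvdn_mull. Qed.
Let p'N : (p' %| N)%N. Proof. by apply: dvdn_trans MpN'; exact: dvdn_mull. Qed.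
Let Kxi : K xi. Proof. exact: KX. Qed.
Let Kxi' : K xi'. Proof. exact: KX. Qed.
Let Kw : K w. Proof. exact: KX. Qed.
Let Kw' : K w'. Proof. exact: KX. Qed.

Let cycP0 := coarse_cyclic K1 KD KN n_gt0 cycP (dvdn_mulr p (dvdnn M)).
Let cycQ0 := coarse_cyclic K1 KD KN n'_gt0 cycQ (dvdn_mulr p' (dvdnn M')).

Let LD x y : L x -> L y -> L (x + y).
Proof. by case=> xP xQ [yP yQ]; split; rewrite (cycD cycP0, cycD cycQ0) (xP, xQ) (yP, yQ). Qed.

Let LK c x : K c -> L x -> L (c * x).
Proof. by move=> Kc [xP xQ]; split; rewrite (cycK cycP0, cycK cycQ0) // (xP, xQ). Qed.

Let LN x : L x -> L (- x).
Proof. by rewrite -mulN1r; apply: LK; exact: KN. Qed.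

Let L0 : L 0.
Proof. by split; rewrite (cyc0 K1 KD KN cycP0, cyc0 K1 KD KN cycQ0). Qed.

Let LB x y : L x -> L y -> L (x - y).
Proof. by move=> Lx Ly; exact/LD/LN. Qed.

Let L_sum (I : Type) (s : seq I) (R : pred I) (x : I -> S) :
  (forall i, R i -> L (x i)) -> L (\sum_(i <- s | R i) x i).
Proof. by move=> Lx; elim/big_rec: _ => // i y Ri; exact/LD/Lx. Qed.

Let LP a y : (a < n)%N -> L y -> L (P a y).
Proof.
move=> an [yP yQ]; split; last by rewrite -commQP // yQ.
by rewrite (cyc_coarse_comm _ _ _ cycP) // yP.
Qed.

Let LQ b y : (b < n')%N -> L y -> L (Q b y).
Proof.
move=> bn [yP yQ]; split; first by rewrite commPQ // yP.
by rewrite (cyc_coarse_comm _ _ _ cycQ) // yQ.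
Qed.

Let Ltwist v y : K v -> L y -> L (twist n P v y).
Proof. by move=> Kv Ly; apply: L_sum => a _; apply: LK; [exact: KX | exact: LP]. Qed.

Let Ltwist' v y : K v -> L y -> L (twist n' Q v y).
Proof. by move=> Kv Ly; apply: L_sum => a _; apply: LK; [exact: KX | exact: LQ]. Qed.

Let LA y : L y -> L (leaf_part M p P a0 y).
Proof.
move=> Ly; apply: L_sum => a _; apply: LK; last exact: LP.
by apply: K_sum => l _; exact: KX.
Qed.

Let LB' y : L y -> L (leaf_part M' p' Q b0 y).
Proof.
move=> Ly; apply: L_sum => b _; apply: LK; last exact: LQ.
by apply: K_sum => l _; exact: KX.
Qed.

(* On L, both twists are scalar multiples of maps 1 + (w - 1) A and 1 + (w' - 1) B. *)
Let twist_commutator y : L y -> exists2 v, L v &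
  twist n P xi (twist n' Q xi' y) =
  twist n' Q xi' (twist n P xi y) + (w - 1) * (w' - 1) * v.
Proof.
move=> Ly; set A := leaf_part M p P a0; set B := leaf_part M' p' Q b0.
have sE x : L x -> twist n P xi x = xi ^+ a0 * (x + (w - 1) * A x).
  by case=> xP _; exact: (twist_leaf p_pr MpN cycP).
have tE x : L x -> twist n' Q xi' x = xi' ^+ b0 * (x + (w' - 1) * B x).
  by case=> _ xQ; exact: (twist_leaf p'_pr MpN' cycQ).
have [Ka Kb] : K (xi ^+ a0) /\ K (xi' ^+ b0) by split; exact: KX.
have [Kw1 Kw2] : K (w - 1) /\ K (w' - 1) by split; exact/KD/KN.
exists (xi ^+ a0 * xi' ^+ b0 * (A (B y) - B (A y))).
  apply: LK; [exact: KM | apply: LB].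
    by apply: LA; exact: LB'.
  by apply: LB'; exact: LA.
rewrite (tE _ Ly) (twistK cycP) // (twistD cycP) (twistK cycP) // !sE //; last exact: LB'.
rewrite (twistK cycQ) // (twistD cycQ) (twistK cycQ) // !tE //; last exact: LA.
by ring.
Qed.

(** The commutator of the twists s and t is the identity modulo (w - 1) (w' - 1) on L, so
    [rigid_automorphism] applies to it. *)
Let leaf_twists_commute y : L y ->
  twist n P xi (twist n' Q xi' y) = twist n' Q xi' (twist n P xi y).
Proof.
have xin : xi ^+ n = 1 by exact: twist_root_order.
have xin' : xi' ^+ n' = 1 by exact: twist_root_order.
pose xj := xi ^+ n.-1; pose xj' := xi' ^+ n'.-1.
have Kxj : K xj by exact: KX.
have Kxj' : K xj' by exact: KX.
have xiK : xi * xj = 1 by rewrite -exprS prednK.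
have xiK' : xi' * xj' = 1 by rewrite -exprS prednK.
have xjn : xj ^+ n = 1 by rewrite -exprM mulnC exprM xin expr1n.
have xjn' : xj' ^+ n' = 1 by rewrite -exprM mulnC exprM xin' expr1n.
have [s sE] := twist_rmorphism K1 KD KN n_gt0 cycP xin.
have [t tE] := twist_rmorphism K1 KD KN n'_gt0 cycQ xin'.
have [s' s'E] := twist_rmorphism K1 KD KN n_gt0 cycP xjn.
have [t' t'E] := twist_rmorphism K1 KD KN n'_gt0 cycQ xjn'.
have sK : cancel s s'.
  by move=> x; rewrite sE s'E (twist_comp K1 KD KN KM cycP) // mulrC.
have s'K : cancel s' s.
  by move=> x; rewrite sE s'E (twist_comp K1 KD KN KM cycP).
have tK : cancel t t'.
  by move=> x; rewrite tE t'E (twist_comp K1 KD KN KM cycQ) // mulrC.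
have t'K : cancel t' t.
  by move=> x; rewrite tE t'E (twist_comp K1 KD KN KM cycQ).
pose c : {rmorphism S -> S} := s \o (t \o (s' \o t')).
pose c' : {rmorphism S -> S} := t \o (s \o (t' \o s')).
have cK : cancel c c' by move=> x; rewrite /c /c' /= sK tK s'K t'K.
have c'K : cancel c' c by move=> x; rewrite /c /c' /= tK sK t'K s'K.
have fixK (x : S) : K x -> c x = x.
  move=> Kx; have fix1 m R v : (0 < m)%N -> cyclic_grading K m R -> twist m R v x = x.
    by move=> m_gt0 cycR; rewrite -{1}[x]mulr1 (twistK cycR) // (twist1 m_gt0 cycR) mulr1.
  by rewrite /c /= t'E fix1 // s'E fix1 // tE fix1 // sE fix1.
have Ls x : L x -> L (s x) by rewrite sE; exact: Ltwist.
have Ls' x : L x -> L (s' x) by rewrite s'E; exact: Ltwist.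
have Lt x : L x -> L (t x) by rewrite tE; exact: Ltwist'.
have Lt' x : L x -> L (t' x) by rewrite t'E; exact: Ltwist'.
have cong : congruent_id L ((w - 1) * (w' - 1)) c.
  move=> x Lx; have [v Lv] := twist_commutator (Ls' _ (Lt' _ Lx)).
  by rewrite -sE -tE -sE -tE s'K t'K; exists v.
have Kpi : K (w - 1) by exact/KD/KN.
have Kpi' : K (w' - 1) by exact/KD/KN.
have unifp : uniformizer L p (w - 1).
  by apply: root_of_unity_uniformizer => //; exact: zsum.
have unifp' : uniformizer L p' (w' - 1).
  by apply: root_of_unity_uniformizer => //; exact: zsum.
have congp : congruent_id L (w - 1) c.
  by move=> x /cong[v Lv ->]; exists ((w' - 1) * v); [exact: LK | rewrite mulrA].
have congp' : congruent_id L (w' - 1) c.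
  by move=> x /cong[v Lv ->]; exists ((w - 1) * v); [exact: LK | rewrite mulrA (mulrC (w' - 1))].
(* If p = p' the modulus is a square, which serves every l; otherwise the one of p and p' that
   differs from l is taken. *)
have rigc l : prime l -> rigid_at L l c.
  move=> _; have [eqpp|neqpp] := eqVneq p p'.
    exists p, (w - 1); split=> //; [exact: fixK | exact: regN | exact: sepN |].
    by split=> //; right; move: cong; rewrite /w' -eqpp expr2.
  have [eqlp|neqlp] := eqVneq l p.
    exists p', (w' - 1); split=> //; [exact: fixK | exact: regN | exact: sepN |].
    by split=> //; left=> eqlp'; case/eqP: neqpp; rewrite -eqlp.
  exists p, (w - 1); split=> //; [exact: fixK | exact: regN | exact: sepN |].
  by split=> //; left; exact/eqP.
move=> Ly; rewrite -tE -sE -sE -tE.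
(* The commutator sends t (s y) to s (t y), so its fixing t (s y) is the claim. *)
have [d [a [Ka inty]]] := intS (t (s y)).
have := rigid_automorphism LD LN redS accS cK c'K rigc (Lt _ (Ls _ Ly)) (fun i => fixK _ (Ka i)) inty.
by rewrite /c /= tK sK.
Qed.

Let homog_commute (m : nat) (R : nat -> S -> S) (F : S -> S) y a :
  cyclic_grading K m R -> (a < m)%N -> F 0 = 0 ->
  (forall x z, F (x + z) = F x + F z) ->
  (forall b, (b < m)%N -> R b (F (R b y)) = F (R b y)) ->
  R a (F y) = F (R a y).
Proof.
move=> cycR am F0 FD FR; rewrite -{1}(cyc_sum cycR y).
have -> : F (\sum_(b < m) R b y) = \sum_(b < m) F (R b y).
  by elim/big_rec2: _ => // i y1 y2 _ <-; rewrite FD.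
rewrite (cyc_big K1 KD KN cycR) (bigD1 (Ordinal am)) //= FR // big1 ?addr0 // => b neqba.
by rewrite -FR // (cyc_orth cycR) // eq_sym (negPf (neqba : (b : nat) != a)).
Qed.

Let twist_eigenP a u : L u -> (a < n)%N -> (a %% M = a0)%N ->
  twist n P xi u = xi ^+ a * u -> P a u = u.
Proof. by case=> uP _ an aa0; apply: (twist_eigen p_pr MpN cycP) aa0 uP => //; exact: regN. Qed.

Let twist_eigenQ b u : L u -> (b < n')%N -> (b %% M' = b0)%N ->
  twist n' Q xi' u = xi' ^+ b * u -> Q b u = u.
Proof. by case=> _ uQ bn bb0; apply: (twist_eigen p'_pr MpN' cycQ) bb0 uQ => //; exact: regN. Qed.

(** Commuting operators preserve each other's eigenspaces, and [twist_eigen] identifies eigenvectors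
    with homogeneous elements. This is used twice: the twist of Q preserves P-degrees, hence
    commutes with P; therefore P preserves Q-degrees. *)
Lemma leaf_commute a b y : coarse n P M a0 y = y -> coarse n' Q M' b0 y = y ->
  (a < n)%N -> (b < n')%N -> P a (Q b y) = Q b (P a y).
Proof.
move=> yP yQ an bn; have Ly : L y by [].
have Pout i x : L x -> (i < n)%N -> (i %% M <> a0)%N -> P i x = 0.
  case=> xP _ ltin /eqP ia; have := coarse_homog cycP M a0 ltin (cyc_proj cycP x ltin).
  by rewrite (negPf ia) (cyc_coarse_comm _ _ _ cycP) // xP.
have Qout i x : L x -> (i < n')%N -> (i %% M' <> b0)%N -> Q i x = 0.
  case=> _ xQ ltin /eqP ia; have := coarse_homog cycQ M' b0 ltin (cyc_proj cycQ x ltin).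
  by rewrite (negPf ia) (cyc_coarse_comm _ _ _ cycQ) // xQ.
have P0 i : P i 0 = 0 by exact: (cyc0 K1 KD KN cycP).
have Q0 i : Q i 0 = 0 by exact: (cyc0 K1 KD KN cycQ).
have T0 : twist n' Q xi' 0 = 0 by rewrite /twist big1 // => i _; rewrite Q0 mulr0.
have PT i x : L x -> (i < n)%N -> P i (twist n' Q xi' x) = twist n' Q xi' (P i x).
  move=> Lx ltin; apply: (homog_commute cycP) => // [x1 x2|j ltjn].
    exact: (twistD cycQ).
  have [ja0|ja0] := pselect (j %% M = a0)%N; last by rewrite (Pout j x) // T0 P0.
  have LPj := LP ltjn Lx; apply: twist_eigenP => //; first exact: Ltwist'.
  rewrite leaf_twists_commute // (twist_homog cycP _ ltjn) ?(cyc_proj cycP) //.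
  by rewrite (twistK cycQ) //; exact: KX.
symmetry; apply: (homog_commute cycQ) => // [x1 x2|j ltjn].
  exact: (cycD cycP).
have [jb0|jb0] := pselect (j %% M' = b0)%N; last by rewrite (Qout j y) // P0 Q0.
have LQj := LQ ltjn Ly; apply: twist_eigenQ => //; first exact: LP.
rewrite -PT // (twist_homog cycQ _ ltjn) ?(cyc_proj cycQ) //.
by rewrite (cycK cycP) //; exact: KX.
Qed.

End TwoLeaves.

(** Induction on n + n'. For n = M p and n' = M' p', the pairs (M, n') and (n, M') are smaller,
    which gives the hypotheses of [leaf_commute] on every common piece of the coarse gradings. *)
Theorem cyclic_gradings_commute n n' P Q a b x : (n %| N)%N -> (n' %| N)%N ->
  cyclic_grading K n P -> cyclic_grading K n' Q -> (a < n)%N -> (b < n')%N ->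
  P a (Q b x) = Q b (P a x).
Proof.
have [m] := ubnP (n + n')%N.
elim: m n n' P Q a b x => // m IHm n n' P Q a b x /ltnSE lem nN n'N cycP cycQ an bn.
have triv k R j z : cyclic_grading K k R -> (j < k)%N -> (k <= 1)%N -> R j z = z.
  move=> cycR jk k1; have k_eq1 : k = 1%N by apply/eqP; rewrite eqn_leq k1 (leq_trans _ jk).
  have := cyc_sum cycR z; move: jk; rewrite k_eq1 big_ord1 ltnS leqn0 => /eqP->.
  by [].
have [n1|n_gt1] := leqP n 1; first by rewrite !(triv n P).
have [n'1|n'_gt1] := leqP n' 1; first by rewrite !(triv n' Q).
have p_pr := pdiv_prime n_gt1; have p'_pr := pdiv_prime n'_gt1.
have /dvdnP[M nE] := pdiv_dvd n; have /dvdnP[M' nE'] := pdiv_dvd n'.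
move: (pdiv n) (pdiv n') p_pr p'_pr nE nE' => p p' p_pr p'_pr nE nE'.
have n_gt0 : (0 < n)%N by exact: ltnW.
have n'_gt0 : (0 < n')%N by exact: ltnW.
have M_gt0 : (0 < M)%N by move: n_gt0; rewrite nE muln_gt0; case/andP.
have M'_gt0 : (0 < M')%N by move: n'_gt0; rewrite nE' muln_gt0; case/andP.
have Mn : (M %| n)%N by rewrite nE dvdn_mulr.
have Mn' : (M' %| n')%N by rewrite nE' dvdn_mulr.
have cycP0 := coarse_cyclic K1 KD KN n_gt0 cycP Mn.
have cycQ0 := coarse_cyclic K1 KD KN n'_gt0 cycQ Mn'.
have ltMn : (M < n)%N by rewrite nE ltn_Pmulr // prime_gt1.
have ltMn' : (M' < n')%N by rewrite nE' ltn_Pmulr // prime_gt1.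
have commPQ i j z : (i < M)%N -> (j < n')%N ->
    coarse n P M i (Q j z) = Q j (coarse n P M i z).
  move=> iM jn; apply: (IHm _ _ _ _ i j z _ _ _ cycP0 cycQ) => //.
    by apply: leq_trans lem; rewrite ltn_add2r.
  exact: dvdn_trans nN.
have commQP i j z : (i < n)%N -> (j < M')%N ->
    P i (coarse n' Q M' j z) = coarse n' Q M' j (P i z).
  move=> ltin jM; apply: (IHm _ _ _ _ i j z _ _ _ cycP cycQ0) => //.
    by apply: leq_trans lem; rewrite ltn_add2l.
  exact: dvdn_trans n'N.
rewrite -{1 2}(cyc_sum cycP0 x) !(cyc_big K1 KD KN cycP, cyc_big K1 KD KN cycQ).
apply: eq_bigr => i _; rewrite -(cyc_sum cycQ0 (coarse n P M i x)).
rewrite !(cyc_big K1 KD KN cycP, cyc_big K1 KD KN cycQ); apply: eq_bigr => j _.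
move: (cyc_proj cycQ0 (coarse n P M i x) (ltn_ord j)) => zQ.
have zP : coarse n P M i (coarse n' Q M' j (coarse n P M i x)) =
          coarse n' Q M' j (coarse n P M i x).
  rewrite (coarse_commute (n := n)) ?(cyc_proj cycP0) //.
  - exact: (cyc0 K1 KD KN cycQ0).
  - exact: (cycD cycQ0).
  - by move=> l z ltln; exact: commQP.
subst n n'; exact: (leaf_commute p_pr p'_pr nN n'N cycP cycQ commPQ commQP
  (ltn_ord i) (ltn_ord j) zP zQ an bn).
Qed.
End CyclicCommute.

(** * Adjoining a root of unity *)

Lemma Cyclotomic_dvd_Xn_sub_1 N : (0 < N)%N ->
  exists q : {poly int}, 'Phi_N * q = 'X^N - 1.
Proof.
move=> N_gt0; exists (\prod_(d <- divisors N | d != N) 'Phi_d).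
rewrite -(prod_Cyclotomic N_gt0) [RHS](bigD1_seq N) ?divisors_uniq //=.
by rewrite -dvdn_divisors.
Qed.

(** With m = N / p, the sum is (X^N - 1) / (X^m - 1), the product of the Phi_d with d dividing N but
    not m; N is one such d. This yields [zsum] for the class of X. *)
Lemma Cyclotomic_dvd_geometric N p : (0 < N)%N -> prime p -> (p %| N)%N ->
  exists q : {poly int}, 'Phi_N * q = \sum_(u < p) ('X^(N %/ p)) ^+ u.
Proof.
move=> N_gt0 p_pr pN; set m := (N %/ p)%N.
have NE : N = (m * p)%N by rewrite divnK.
have m_gt0 : (0 < m)%N by move: N_gt0; rewrite NE muln_gt0; case/andP.
have ltmN : (m < N)%N by rewrite NE ltn_Pmulr // prime_gt1.
pose q : {poly int} := \prod_(d <- divisors N | ~~ (d %| m)%N && (d != N)) 'Phi_d.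
exists q; have Xm0 : 'X^m - 1 != 0 :> {poly int}.
  by rewrite -size_poly_eq0 size_XnsubC.
apply: (mulfI Xm0); rewrite -subrX1 -exprM -NE -(prod_Cyclotomic N_gt0).
rewrite (bigID (fun d => d %| m)%N) /=; congr (_ * _).
  rewrite -(prod_Cyclotomic m_gt0) -[RHS]big_filter; apply: perm_big.
  apply: uniq_perm; rewrite ?filter_uniq ?divisors_uniq // => d.
  rewrite mem_filter -!dvdn_divisors //; case: (boolP (d %| m)%N) => //= dm.
  by rewrite (dvdn_trans dm) // NE dvdn_mulr.
rewrite -[RHS]big_filter [RHS](bigD1_seq N) ?filter_uniq ?divisors_uniq //=.
  by rewrite big_filter_cond.
by rewrite mem_filter -dvdn_divisors // dvdnn andbT gtnNdvd.
Qed.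

Lemma reduced_square (S : comPzRingType) :
  (forall y : S, y ^+ 2 = 0 -> y = 0) -> reduced S.
Proof.
move=> sq0 x; elim=> [|[|n] IHn] x0; last 2 first.
- by rewrite -[x]expr1.
- apply: IHn; apply: sq0; rewrite -exprM.
  by rewrite (_ : n.+1 * 2 = n + n.+2)%N ?exprD ?x0 ?mulr0 // muln2 -addnn addSnnS.
by rewrite -[x]mulr1 -(expr0 x) x0 mulr0.
Qed.

Lemma reduced_poly (R : comNzRingType) : reduced R ->
  forall (q : {poly R}) n, q ^+ n = 0 -> q = 0.
Proof.
move=> redR q n qn0; apply/eqP; rewrite -lead_coef_eq0; apply/eqP.
apply: contrapT => /[dup] c0 /eqP; set c := lead_coef q => c0'.
have cX m : c ^+ m != 0 by apply/eqP => /redR.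
have lcX m : lead_coef (q ^+ m) = c ^+ m.
  elim: m => [|m IHm]; first by rewrite !expr0 lead_coef1.
  by rewrite !exprS lead_coef_proper_mul IHm -?exprS.
by have := lcX n; rewrite qn0 lead_coef0 => /esym/eqP; rewrite (negPf (cX n)).
Qed.

Section IntegralQuotient.
Variables (R : comNzRingType) (g : {poly int}).
Hypotheses (g_monic : g \is monic) (size_g : (1 < size g)%N).

Definition scalar_poly : {poly R} := map_poly intr g.
Notation h := scalar_poly.
Notation S := {poly %/ h}.

Lemma scalar_poly_monic : h \is monic.
Proof. exact: monic_map. Qed.

Lemma size_scalar_poly : size h = size g.
Proof. by rewrite size_map_poly_id0 // (monicP g_monic) rmorph1 oner_neq0. Qed.

Lemma mk_monic_scalar : mk_monic h = h.
Proof. by rewrite /mk_monic size_scalar_poly size_g scalar_poly_monic. Qed.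

Lemma in_qpolyK (s : S) : in_qpoly h s = s.
Proof. by apply/val_inj/in_qpoly_small; exact: size_mk_monic. Qed.

Lemma in_qpolyMn p m : in_qpoly h (p *+ m) = in_qpoly h p *+ m.
Proof. exact: raddfMn. Qed.

Lemma in_qpoly_eq0 p : in_qpoly h p = 0 <-> exists q, p = h * q.
Proof.
split=> [/(congr1 val) /=|[q ->]].
  rewrite mk_monic_scalar => p0; exists (rdivp p h).
  by rewrite {1}(rdivp_eq scalar_poly_monic p) p0 addr0 mulrC.
apply/val_inj; rewrite /= mk_monic_scalar mulrC.
by rewrite rmodp_mull // scalar_poly_monic.
Qed.

(** f tensored with the identity of Z[X]/(g). It is compatible with reduction modulo h because h has
    integer coefficients, which every additive map respects. *)
Definition coef_ext (f : {additive R -> R}) (s : S) : S := in_qpoly h (map_poly f s).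

Lemma map_poly_scalar (f : {additive R -> R}) q :
  map_poly f (h * q) = h * map_poly f q.
Proof.
apply/polyP=> i; rewrite coef_map !coefM raddf_sum; apply: eq_bigr => j _.
by rewrite coef_map !coef_map /= !mulrzl raddfMz.
Qed.

Lemma coef_ext_in f p : coef_ext f (in_qpoly h p) = in_qpoly h (map_poly f p).
Proof.
apply/eqP; rewrite -subr_eq0 /coef_ext -rmorphB -raddfB /=; apply/eqP/in_qpoly_eq0.
have /in_qpoly_eq0[q ->] : in_qpoly h (val (in_qpoly h p) - p) = 0.
  by rewrite rmorphB; apply/eqP; rewrite subr_eq0; apply/eqP; exact: in_qpolyK.
by exists (map_poly f q); rewrite map_poly_scalar.
Qed.


Lemma coef_extD f s t : coef_ext f (s + t) = coef_ext f s + coef_ext f t.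
Proof. by rewrite /coef_ext !raddfD. Qed.

Lemma coef_extN f s : coef_ext f (- s) = - coef_ext f s.
Proof. by rewrite /coef_ext !raddfN. Qed.

(** Scalars of S are defined by their effect on extended K-linear maps, so that closure under ring
    operations is immediate; K and the class of X are among them. *)
Definition ext_scalar (K : R -> Prop) (s : S) : Prop :=
  forall f : {additive R -> R}, (forall c x, K c -> f (c * x) = c * f x) ->
  forall t, coef_ext f (s * t) = s * coef_ext f t.

Section ExtScalar.
Variable K : R -> Prop.

Lemma ext_scalar1 : ext_scalar K 1.
Proof. by move=> f _ t; rewrite !mul1r. Qed.

Lemma ext_scalarD s t : ext_scalar K s -> ext_scalar K t -> ext_scalar K (s + t).
Proof. by move=> Ks Kt f fK u; rewrite !mulrDl coef_extD Ks // Kt. Qed.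

Lemma ext_scalarM s t : ext_scalar K s -> ext_scalar K t -> ext_scalar K (s * t).
Proof. by move=> Ks Kt f fK u; rewrite -!mulrA Ks // Kt. Qed.

Lemma ext_scalarN s : ext_scalar K s -> ext_scalar K (- s).
Proof. by move=> Ks f fK u; rewrite !mulNr coef_extN Ks. Qed.

Lemma ext_scalarX : ext_scalar K (in_qpoly h 'X).
Proof.
move=> f _ t; rewrite -[t]in_qpolyK -in_qpolyM !coef_ext_in -in_qpolyM; congr in_qpoly.
by apply/polyP=> i; rewrite coef_map /= !coefXM coef_map; case: ifP; rewrite ?raddf0.
Qed.

Lemma ext_scalarC c : K c -> ext_scalar K (in_qpoly h c%:P).
Proof.
move=> Kc f fK t; rewrite -[t]in_qpolyK -in_qpolyM !coef_ext_in -in_qpolyM; congr in_qpoly.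
by apply/polyP=> i; rewrite coef_map /= !coefCM coef_map /= fK.
Qed.

Lemma coef_ext_cyclic n (P : nat -> {additive R -> R}) :
  cyclic_grading K n P -> cyclic_grading (ext_scalar K) n (fun a => coef_ext (P a)).
Proof.
move=> cycP; split.
- by move=> a x y; exact: coef_extD.
- by move=> a c x Kc; apply: Kc => d y; exact: (cycK cycP).
- move=> a b s an bn; rewrite coef_ext_in; case: eqP => [->|neqab].
    by congr in_qpoly; apply/polyP=> i; rewrite !coef_map /= (cyc_orth cycP) // eqxx.
  rewrite -[RHS](rmorph0 (in_qpoly h)); congr in_qpoly.
  apply/polyP=> i; rewrite !coef_map coef0 /= (cyc_orth cycP) //.
  by case: eqP neqab.
- move=> s; rewrite -[RHS]in_qpolyK -rmorph_sum; congr in_qpoly.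
  apply/polyP=> i; rewrite coef_sum -[RHS](cyc_sum cycP).
  by apply: eq_bigr => a _; rewrite coef_map.
- rewrite -[1](rmorph1 (in_qpoly h)) coef_ext_in; congr in_qpoly.
  by rewrite -polyC1 map_polyC /= (cyc1 cycP).
move=> a b s t an bn; rewrite -rmorphM coef_ext_in; congr in_qpoly.
apply/polyP=> i; rewrite coef_map !coefM raddf_sum; apply: eq_bigr => j _.
by rewrite !coef_map /= (cycM cycP).
Qed.

End ExtScalar.

Lemma coef_in_qpoly (p : {poly R}) i : (size p < size h)%N -> (in_qpoly h p)`_i = p`_i.
Proof. by move=> szp; rewrite in_qpoly_small // mk_monic_scalar. Qed.

Lemma coef_qpoly_natr m (s : S) i : (m%:R * s)`_i = m%:R * s`_i.
Proof. by rewrite !mulr_natl raddfMn coefMn. Qed.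

Lemma qpoly_regular m : nat_regular R m -> nat_regular S m.
Proof.
move=> regm s ms0; apply/val_inj/polyP => i; rewrite coef0; apply: regm.
by rewrite -coef_qpoly_natr ms0 coef0.
Qed.

Lemma qpoly_separated p : p_separated R p -> p_separated S p.
Proof.
move=> sepp s sp; apply/val_inj/polyP => i; rewrite coef0; apply: sepp => n.
by have [t ->] := sp n; exists t`_i; exact: coef_qpoly_natr.
Qed.

(** Separability: h divides X^N - 1 and N is regular, so the derivative of h is regular modulo h. If
    y^2 = 0, this lifts to divisibility of f^(j+1) by h^j for every j, where f is the reduced
    representative of y. *)
Lemma qpoly_reduced N q : (0 < N)%N -> g * q = 'X^N - 1 ->
  reduced R -> (forall m, (0 < m)%N -> nat_regular R m) -> reduced S.
Proof.
move=> N_gt0 gq redR regR; apply: reduced_square => y y2.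
pose D := (size h).-1; pose f : {poly R} := y.
pose x : S := in_qpoly h 'X.
have inh : in_qpoly h h = 0 by apply/in_qpoly_eq0; exists 1; rewrite mulr1.
have hq : h * map_poly intr q = 'X^N - 1.
  by rewrite -rmorphM gq rmorphB /= map_polyXn rmorph1.
have xN : x ^+ N = 1.
  apply/eqP; rewrite -subr_eq0 -rmorphXn -(rmorph1 (in_qpoly h)) -rmorphB.
  by apply/eqP/in_qpoly_eq0; exists (map_poly intr q); rewrite hq.
(* Multiplied by x this becomes the integer N, since x^N = 1. *)
have h'q : in_qpoly h (h^`() * map_poly intr q) = N%:R * x ^+ N.-1.
  have := congr1 (in_qpoly h \o deriv) hq.
  rewrite /= derivM derivB derivXn derivC subr0 in_qpolyD !in_qpolyM inh mul0r addr0 => ->.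
  by rewrite rmorphMn rmorphXn mulr_natl.
(* Differentiating this equation shows that f H vanishes modulo h; for large j
   it forces H = 0 by degree. *)
have step j : exists H, f ^+ j.+1 = h ^+ j * H.
  elim: j => [|j [H IHj]]; first by exists f; rewrite expr1 expr0 mul1r.
  suff /in_qpoly_eq0[H' eqH'] : in_qpoly h (f * H) = 0.
    by exists H'; rewrite exprSr IHj -mulrA (mulrC H) eqH' mulrA -exprSr.
  case: j IHj => [|j] IHj.
    by move: IHj; rewrite expr1 expr0 mul1r => <-; rewrite -expr2 rmorphXn /= in_qpolyK.
  have hj_reg : GRing.lreg (h ^+ j).
    by apply/lreg_lead; rewrite (monicP (monic_exp _ scalar_poly_monic)); exact: lreg1.
  have eqH : h^`() * (f * H) *+ j.+1 = h * (H * f^`() *+ j.+2 - f * H^`()).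
    apply: hj_reg; have := congr1 (fun p => f * deriv p) IHj.
    rewrite derivM !deriv_exp /= => eqd.
    have -> : h ^+ j * (h^`() * (f * H) *+ j.+1) =
        f * (h^`() * h ^+ j *+ j.+1 * H + h ^+ j.+1 * H^`()) - h ^+ j.+1 * (f * H^`()).
      by ring.
    rewrite -eqd.
    have -> : f * (f^`() * f ^+ j.+1 *+ j.+2) = h ^+ j.+1 * (H * f^`() *+ j.+2).
      by rewrite mulrnAr mulrCA -exprS IHj -mulrnAr; ring.
    by rewrite -mulrBr exprSr -mulrA.
  have {eqH} : in_qpoly h (h^`() * map_poly intr q * (f * H) *+ j.+1) = 0.
    have -> : h^`() * map_poly intr q * (f * H) *+ j.+1 =
        map_poly intr q * (h^`() * (f * H) *+ j.+1) by ring.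
    by rewrite eqH mulrCA in_qpolyM inh mul0r.
  rewrite in_qpolyMn in_qpolyM h'q => /(congr1 ( *%R x)).
  rewrite mulr0 mulrnAr mulrA mulrCA -exprS prednK // xN mulr1 -mulr_natl.
  by move/(qpoly_regular (regR _ (ltn0Sn j)))/(qpoly_regular (regR _ N_gt0)).
(* D is the degree of h. As f has degree at most D - 1, its power D + 1 has degree at most D^2 - 1,
   below the degree D^2 of h^D. *)
have [H eqH] := step D.
have D_gt0 : (0 < D)%N by rewrite /D size_scalar_poly -ltnS prednK // ltnW.
have szf : (size f <= D)%N.
  have szy : (size f < size (mk_monic h))%N := size_mk_monic y.
  by move: szy; rewrite mk_monic_scalar /D; case: (size h).
have hX_monic n : h ^+ n \is monic by exact: monic_exp scalar_poly_monic.
have size_hX n : size (h ^+ n) = (D * n).+1.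
  elim: n => [|n IHn]; first by rewrite expr0 size_poly1 muln0.
  rewrite exprS size_monicM ?scalar_poly_monic ?monic_neq0 // IHn addnS /= mulnS -addSn.
  by rewrite /D prednK // size_scalar_poly ltnW.
have H0 : H = 0.
  apply: contrapT => /eqP H0; have := size_poly_exp_leq f D.+1.
  rewrite eqH mulrC size_Mmonic // size_hX addnS /= leqNgt => /negP; apply.
  apply: (@leq_ltn_trans (D * D)%N); last first.
    by rewrite -[X in (X < _)%N]add0n ltn_add2r size_poly_gt0.
  have -> : (D * D = (D.-1 * D.+1).+1)%N.
    by case: (D) D_gt0 => // d _ /=; rewrite mulSn [in RHS]mulnS addSn.
  by rewrite ltnS leq_mul2r /= -!subn1 leq_sub2r.
have f0 : f = 0 by apply: (reduced_poly redR (n := D.+1)); rewrite eqH H0 mulr0.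
exact/val_inj.
Qed.

End IntegralQuotient.

Section Descent.
Variables (k : comPzRingType) (R : comNzRingType) (iota : {rmorphism k -> R}).
Variables (N : nat) (N_gt0 : (0 < N)%N).
Notation h := (scalar_poly R 'Phi_N).
Notation S := {poly %/ h}.

Let Phi_monic : 'Phi_N \is monic. Proof. exact: Cyclotomic_monic. Qed.
Let Phi_size : (1 < size 'Phi_N)%N.
Proof. by rewrite size_Cyclotomic ltnS totient_gt0. Qed.

Definition iota_ext : {rmorphism k -> S} := qpolyC h \o iota.

Lemma iota_extE c : iota_ext c = in_qpoly h (iota c)%:P.
Proof.
apply/val_inj; symmetry; apply: in_qpoly_small.
by rewrite (leq_ltn_trans (size_polyC_leq1 _)) // size_mk_monic_gt1.
Qed.

Lemma kmod_fin_gen_ext : kmod_fin_gen iota -> kmod_fin_gen iota_ext.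
Proof.
case=> gens spanR.
pose gens' := [seq in_qpoly h (c *: 'X^i) | c <- gens, i <- seq.iota 0 (size h)].
exists gens' => s; rewrite -/(kspan iota_ext gens' s).
have kS := kspan_ksubmod iota_ext gens'.
rewrite -[s]in_qpolyK -[val s]coefK poly_def rmorph_sum.
apply: (ksubmod_sum _ kS) => i _; have [cs [_ ->]] := spanR (val s)`_i.
rewrite scaler_suml rmorph_sum; apply: (ksubmod_sum _ kS) => l _.
rewrite [X in kspan _ _ X](_ : _ = iota_ext cs`_l * in_qpoly h (gens`_l *: 'X^i)); last first.
  by rewrite iota_extE -in_qpolyM mul_polyC scalerA.
case: kS => _ _; apply; apply: kspan_mem; apply: allpairs_f; first exact: mem_nth.
rewrite mem_iota add0n (leq_trans (ltn_ord i)) // ltnW //.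
by apply: leq_trans (size_mk_monic s) _; rewrite mk_monic_scalar.
Qed.

(** Both gradings are extended to R[X]/(Phi_N), where the class of X is the required root of unity;
    the identity in R is then read off the constant coefficient. *)
Theorem cyclic_gradings_commute_nz (n n' : nat) (P Q : nat -> R -> R) a b x :
  noetherian k -> reduced R -> kmod_fin_gen iota ->
  (forall m, (0 < m)%N -> nat_regular R m) ->
  (forall p, prime p -> (p %| N)%N -> p_separated R p) ->
  (n %| N)%N -> (n' %| N)%N ->
  cyclic_grading (fun c => exists d, c = iota d) n P ->
  cyclic_grading (fun c => exists d, c = iota d) n' Q ->
  (a < n)%N -> (b < n')%N -> P a (Q b x) = Q b (P a x).
Proof.
set K := fun c => exists d, c = iota d.
move=> noek redR genR regR sepR nN n'N cycP cycQ an bn.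
have KN1 : K (-1) by exists (-1); rewrite rmorphN1.
have add_of m (T : nat -> R -> R) : cyclic_grading K m T ->
    {f : nat -> {additive R -> R} | forall i, f i =1 T i}.
  move=> cycT; have zm i : zmod_morphism (T i).
    move=> y z; rewrite (cycD cycT) -mulN1r (cycK cycT) ?mulN1r //.
  pose f i : {additive R -> R} := HB.pack (T i) (GRing.isZmodMorphism.Build R R (T i) (zm i)).
  by exists f.
have [p pE] := add_of _ _ cycP; have [q qE] := add_of _ _ cycQ.
have cycp : cyclic_grading K n p.
  by case: cycP => ? ? ? ? ? ?; split; move=> *; rewrite ?pE; auto;
     under eq_bigr do rewrite pE.
have cycq : cyclic_grading K n' q.
  by case: cycQ => ? ? ? ? ? ?; split; move=> *; rewrite ?qE; auto;
     under eq_bigr do rewrite qE.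
have [g gN] := Cyclotomic_dvd_Xn_sub_1 N_gt0.
pose z : S := in_qpoly h 'X.
have accS : ascending_stable (ksubmod iota_ext).
  exact: noetherian_ksubmod (kmod_fin_gen_ext genR).
have accI : ascending_stable (@is_ideal S).
  apply: ascending_stable_sub accS => I; exact: ideal_ksubmod.
have zN : z ^+ N = 1.
  apply/eqP; rewrite -subr_eq0 -rmorphXn -(rmorph1 (in_qpoly h)) -rmorphB.
  apply/eqP/in_qpoly_eq0 => //; exists (map_poly intr g).
  by rewrite -rmorphM gN rmorphB /= map_polyXn rmorph1.
have zsum l : prime l -> (l %| N)%N -> \sum_(u < l) (z ^+ (N %/ l)) ^+ u = 0.
  move=> l_pr lN; have [f fE] := Cyclotomic_dvd_geometric N_gt0 l_pr lN.
  under eq_bigr do rewrite -!rmorphXn; rewrite -rmorph_sum.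
  apply/in_qpoly_eq0 => //; exists (map_poly intr f).
  by rewrite -rmorphM fE rmorph_sum; apply: eq_bigr => u _; rewrite !rmorphXn /= map_polyX.
have intS (y : S) : exists (d : nat) (c : nat -> S),
    (forall i, ext_scalar K (c i)) /\ y ^+ d + \sum_(i < d) c i * y ^+ i = 0.
  have [d [c cE]] := ascending_integral accS y; exists d, (fun i => iota_ext (c i)).
  by split=> // i; rewrite iota_extE; apply: ext_scalarC => //; exists (c i).
have /(congr1 (fun s : S => s`_0)) : coef_ext (p a) (coef_ext (q b) (in_qpoly h x%:P)) =
    coef_ext (q b) (coef_ext (p a) (in_qpoly h x%:P)).
  apply: (@cyclic_gradings_commute S (ext_scalar K) _ _ _ _ N z N_gt0 _ zN zsum _ accI
    _ _ intS n n' (fun i => coef_ext (p i)) (fun i => coef_ext (q i))) => //.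
  - exact: ext_scalar1.
  - exact: ext_scalarD.
  - exact: ext_scalarN.
  - exact: ext_scalarM.
  - exact: ext_scalarX.
  - exact: (qpoly_reduced Phi_monic Phi_size N_gt0 gN redR regR).
  - by move=> l l_pr lN; apply/qpoly_regular/regR/prime_gt0.
  - by move=> l l_pr lN; apply/qpoly_separated/sepR.
  - exact: coef_ext_cyclic.
  - exact: coef_ext_cyclic.
rewrite !coef_ext_in // !map_polyC /= !pE !qE.
have size_C (c : R) : (size c%:P < size h)%N.
  by rewrite (leq_ltn_trans (size_polyC_leq1 _)) // size_scalar_poly.
by rewrite !coef_in_qpoly // !coefC /=.
Qed.
End Descent.

(* Polynomials need a non-trivial coefficient ring; destructing R exposes its
   operations, which the packed structure then shares up to conversion. *)
Lemma nontrivial_comNzRing (R : comPzRingType) : (1 : R) != 0 ->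
  exists R' : comNzRingType, R = R' :> comPzRingType.
Proof.
case: R => T [] m1 m2 m3 m4 m5 m6 m7 m8 m9 m10 m11.
set R := GRing.ComPzRing.Pack _ => R1.
by exists (HB.pack_for comNzRingType T R (GRing.PzSemiRing_isNonZero.Build R R1)).
Qed.

Theorem cyclic_gradings_commute_noetherian (k R : comPzRingType) (iota : {rmorphism k -> R})
    (N n n' : nat) (P Q : nat -> R -> R) a b x :
  noetherian k -> reduced R -> kmod_fin_gen iota -> (0 < N)%N ->
  (forall m, (0 < m)%N -> nat_regular R m) ->
  (forall p, prime p -> (p %| N)%N -> p_separated R p) ->
  (n %| N)%N -> (n' %| N)%N ->
  cyclic_grading (fun c => exists d, c = iota d) n P ->
  cyclic_grading (fun c => exists d, c = iota d) n' Q ->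
  (a < n)%N -> (b < n')%N -> P a (Q b x) = Q b (P a x).
Proof.
have [R0|/nontrivial_comNzRing[R' ER]] := eqVneq (1 : R) 0.
  by move=> *; rewrite -[LHS]mul1r -[RHS]mul1r R0 !mul0r.
subst R; move=> noek redR genR N_gt0.
exact: (@cyclic_gradings_commute_nz k R' iota N N_gt0).
Qed.

(** * Projections of a grading *)

Lemma sum_restrict (V : nmodType) (T : eqType) (s u : seq T) (x : T -> V) :
  uniq s -> uniq u -> {subset s <= u} ->
  \sum_(g <- u) (if g \in s then x g else 0) = \sum_(g <- s) x g.
Proof.
move=> us uu su; rewrite -big_mkcond -big_filter; apply: perm_big.
apply: uniq_perm => [||g]; rewrite ?filter_uniq // mem_filter andb_idr //; exact: su.
Qed.

Section Components.
Variables (k R : comPzRingType) (iota : {rmorphism k -> R}).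

Record graded_components (G : zmodType) (M : G -> R -> Prop) (s : seq G)
    (comp : G -> R -> R) : Prop := GradedComponents {
  gc_uniq : uniq s;
  gc_mem : forall g r, M g (comp g r);
  gc_sum : forall r, \sum_(g <- s) comp g r = r;
  gc_homog : forall g r h, M g r -> comp h r = if h == g then r else 0;
  gcD : forall g x y, comp g (x + y) = comp g x + comp g y;
  gcZ : forall g c x, comp g (iota c * x) = iota c * comp g x;
  gc_out : forall g r, g \notin s -> comp g r = 0 }.

Section Existence.
Variables (G : zmodType) (M : G -> R -> Prop).
Hypothesis grM : is_grading iota M.

Let kM g : ksubmod iota (M g). Proof. by case: grM. Qed.
Let M0 g : M g 0. Proof. by case: (kM g). Qed.

(** Decompositions may use different lists of degrees, so they are compared after extension by zero
    to the union. *)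
Lemma graded_sum_unique (t t' : seq G) (x x' : G -> R) : uniq t -> uniq t' ->
  (forall g, M g (x g)) -> (forall g, M g (x' g)) ->
  \sum_(g <- t) x g = \sum_(g <- t') x' g ->
  forall h, (if h \in t then x h else 0) = (if h \in t' then x' h else 0).
Proof.
move=> ut ut' Mx Mx' eqsum h; pose u := undup (t ++ t').
have uu : uniq u by exact: undup_uniq.
pose z g := (if g \in t then x g else 0) - (if g \in t' then x' g else 0).
have [_ _ inj _ _] := grM; have zu := inj u z uu.
case hu : (h \in u); last first.
  by move: hu; rewrite mem_undup mem_cat => /negbT; rewrite negb_or => /andP[/negPf-> /negPf->].
apply/eqP; rewrite -subr_eq0; apply/eqP; apply: (zu _ _ h hu) => [g|].
  by apply: (ksubmodB (kM g)); case: ifP.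
rewrite sumrB !sum_restrict ?eqsum ?subrr // => g gt;
  by rewrite mem_undup mem_cat gt ?orbT.
Qed.

(** Decompositions are chosen elementwise; their uniqueness makes the components k-linear, and the
    degrees occurring in the generators then serve for all elements. *)
Lemma grading_components : kmod_fin_gen iota ->
  exists s comp, graded_components M s comp.
Proof.
case=> gens spanR; have [_ surj _ _ _] := grM.
have /choice[f fP] : forall r, exists sx : seq G * (G -> R), uniq sx.1 /\
    (forall g, M g (sx.2 g)) /\ r = \sum_(g <- sx.1) sx.2 g.
  by move=> r; have [s [x sxP]] := surj r; exists (s, x).
pose comp g r := if g \in (f r).1 then (f r).2 g else 0.
have compE t x r h : uniq t -> (forall g, M g (x g)) -> r = \sum_(g <- t) x g ->
    comp h r = if h \in t then x h else 0.
  move=> ut Mx rE; have [uf [Mf fE]] := fP r.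
  by apply: graded_sum_unique => //; rewrite -fE.
have Mcomp g r : M g (comp g r) by rewrite /comp; case: ifP => // _; have [_ []] := fP r.
have sumcomp u r : uniq u -> {subset (f r).1 <= u} -> \sum_(g <- u) comp g r = r.
  by move=> uu su; have [uf [Mf fE]] := fP r; rewrite sum_restrict.
have compD g x y : comp g (x + y) = comp g x + comp g y.
  pose u := undup ((f x).1 ++ (f y).1).
  have xu : {subset (f x).1 <= u} by move=> h hx; rewrite mem_undup mem_cat hx.
  have yu : {subset (f y).1 <= u} by move=> h hy; rewrite mem_undup mem_cat hy orbT.
  rewrite (compE u (fun h => comp h x + comp h y)) ?undup_uniq //.
  - case: ifP => // /negP gu; rewrite /comp.
    by have [/xu|_] := boolP (g \in _) => //; have [/yu|_] := boolP (g \in _) => //; rewrite addr0.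
  - by move=> h; case: (kM h) => _ + _; apply.
  by rewrite big_split /= !sumcomp ?undup_uniq.
have compZ g c x : comp g (iota c * x) = iota c * comp g x.
  rewrite (compE (f x).1 (fun h => iota c * comp h x)).
  - by rewrite /comp; case: ifP => gf; rewrite ?gf ?mulr0.
  - by have [] := fP x.
  - by move=> h; case: (kM h) => _ _; apply.
  by rewrite -mulr_sumr sumcomp //; have [] := fP x.
have comp0 g : comp g 0 = 0 by rewrite -{1}(mul0r 0) -(rmorph0 iota) compZ rmorph0 mul0r.
have comp_big g (I : Type) (s : seq I) (x : I -> R) :
    comp g (\sum_(i <- s) x i) = \sum_(i <- s) comp g (x i).
  by elim/big_rec2: _ => // i y1 y2 _ <-; rewrite compD.
pose s := undup (flatten [seq (f g).1 | g <- gens]).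
have compout g r : g \notin s -> comp g r = 0.
  move=> gs; have [cs [_ ->]] := spanR r; rewrite comp_big big1 // => i _.
  rewrite compZ /comp ifF ?mulr0 //; apply: contraNF gs => gf.
  rewrite mem_undup; apply/flattenP; exists (f gens`_i).1 => //.
  by apply/map_f/mem_nth.
exists s, comp; split=> //; first exact: undup_uniq.
- move=> r; pose u := undup (s ++ (f r).1).
  have uu : uniq u by exact: undup_uniq.
  rewrite -[RHS](sumcomp u) //; last by move=> h hr; rewrite mem_undup mem_cat hr orbT.
  rewrite -(@sum_restrict _ _ s u) ?undup_uniq //.
    by apply: eq_bigr => g _; case: ifP => // /negbT/compout->.
  by move=> h hs; rewrite mem_undup mem_cat hs.
move=> g r h Mr; rewrite (compE [:: g] (fun h => if h == g then r else 0)) //.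
- by rewrite inE; case: eqP.
- by move=> h'; case: eqP => // ->.
by rewrite big_seq1 eqxx.
Qed.
End Existence.

Section Theory.
Variables (G : zmodType) (M : G -> R -> Prop) (s : seq G) (comp : G -> R -> R).
Hypothesis gcM : graded_components M s comp.

Lemma gc0 g : comp g 0 = 0.
Proof. by rewrite -{1}(mul0r 0) -(rmorph0 iota) (gcZ gcM) rmorph0 mul0r. Qed.

Lemma gc_big g (I : Type) (t : seq I) (P : pred I) (x : I -> R) :
  comp g (\sum_(i <- t | P i) x i) = \sum_(i <- t | P i) comp g (x i).
Proof. by elim/big_rec2: _ => [|i y1 y2 _ <-]; rewrite ?gc0 ?(gcD gcM). Qed.

Lemma gc_comp g h r : comp g (comp h r) = if g == h then comp h r else 0.
Proof. exact: (gc_homog gcM _ (gc_mem gcM h r)). Qed.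

Lemma gc_memP g r : M g r <-> comp g r = r.
Proof.
by split=> [/(gc_homog gcM)->|<-]; [rewrite eqxx | exact: (gc_mem gcM)].
Qed.

Lemma gc_commute (F : R -> R) g r :
  (forall x y, F (x + y) = F x + F y) ->
  (forall g h r, M g r -> g \in s -> h != g -> comp h (F r) = 0) ->
  F (comp g r) = comp g (F r).
Proof.
move=> FD Fcomp.
have F0 : F 0 = 0 by apply: (addrI (F 0)); rewrite -FD !addr0.
have F_big (t : seq G) (x : G -> R) : F (\sum_(i <- t) x i) = \sum_(i <- t) F (x i).
  by elim/big_rec2: _ => // i y1 y2 _ <-; rewrite FD.
have eqF h : h \in s -> comp h (F (comp h r)) = F (comp h r).
  move=> hs; rewrite -[RHS](gc_sum gcM) (bigD1_seq h) ?(gc_uniq gcM) //= big1 ?addr0 // => h' neqhh.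
  exact: Fcomp (gc_mem gcM h r) hs neqhh.
rewrite -{2}(gc_sum gcM r) F_big gc_big.
have [gs|gs] := boolP (g \in s).
  rewrite (bigD1_seq g) ?(gc_uniq gcM) //= eqF // big1_seq ?addr0 // => h /andP[neqhg hs].
  by apply: Fcomp (gc_mem gcM h r) hs _; rewrite eq_sym.
by rewrite (gc_out gcM) // F0 big1_seq // => h /andP[_ hs]; rewrite (gc_out gcM).
Qed.

End Theory.
End Components.

(** * Characters of torsion groups *)

Section Characters.
Variables (G : zmodType) (n : nat).
Notation N := n.+1.

(** A character of a subgroup H of exponent dividing N; values of chi off H carry no meaning.
    Opposites are natural multiples, -x = n x, so closure under addition is enough. *)
Record character_on (H : G -> Prop) (chi : G -> 'I_N) : Prop := CharacterOn {
  ch0 : H 0;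
  chD : forall x y, H x -> H y -> H (x + y);
  ch_tors : forall x, H x -> x *+ N = 0;
  ch_add : forall x y, H x -> H y -> chi (x + y) = chi x + chi y }.

Lemma Zp_mulrN (t : 'I_N) : t *+ N = 0.
Proof. by rewrite Zp_mulrn; apply/val_inj; rewrite /= mulnC modnMr. Qed.

Section OneCharacter.
Variables (H : G -> Prop) (chi : G -> 'I_N).
Hypothesis chH : character_on H chi.

Lemma ch_zero : chi 0 = 0.
Proof.
by apply: (addrI (chi 0)); rewrite -(ch_add chH) ?addr0; case: chH.
Qed.

Lemma ch_mulrn x j : H x -> H (x *+ j) /\ chi (x *+ j) = chi x *+ j.
Proof.
move=> Hx; elim: j => [|j [Hxj IHj]]; first by rewrite !mulr0n ch_zero; case: chH.
by rewrite !mulrS (ch_add chH) // IHj; split=> //; exact: (chD chH).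
Qed.

Lemma ch_opp x : H x -> H (- x).
Proof.
move=> Hx; have [+ _] := ch_mulrn n Hx; congr H.
by apply/eqP; rewrite -addr_eq0 -mulrSr (ch_tors chH).
Qed.

(** Extension to the subgroup generated by H and g. The condition on t is compatibility on the
    multiples of g that lie in H, and it makes the value independent of the expression h + j g. *)
Lemma character_extend g (t : 'I_N) : g *+ N = 0 ->
  (forall j, H (g *+ j) -> chi (g *+ j) = t *+ j) ->
  exists H' chi', [/\ character_on H' chi', (forall x, H x -> H' x), H' g,
    forall x, H x -> chi' x = chi x & chi' g = t].
Proof.
move=> gN tg.
pose H' x := exists hj : G * nat, H hj.1 /\ x = hj.1 + g *+ hj.2.
have /choice[f fP] : forall x, exists hj : G * nat, H' x -> H hj.1 /\ x = hj.1 + g *+ hj.2.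
  by move=> x; have [[hj hjP]|nH] := pselect (H' x); [exists hj | exists (0, 0%N)].
pose chi' x := chi (f x).1 + t *+ (f x).2.
have chi'E h j : H h -> chi' (h + g *+ j) = chi h + t *+ j.
  move=> Hh; rewrite /chi'; have [|Hh1] := fP (h + g *+ j); first by exists (h, j).
  move: (f _) Hh1 => [h1 j1] /= Hh1 eqh.
  (* To remain with natural multiples, subtraction of j1 g is written as addition of n j1 g, and
     similarly for h. *)
  have eqg : g *+ (j + n * j1) = h1 + h *+ n.
    have -> : h1 = h + g *+ j - g *+ j1 by rewrite eqh addrK.
    rewrite mulrnDr mulnC mulrnA.
    have -> : g *+ j1 *+ n = - (g *+ j1).
      by apply/eqP; rewrite -addr_eq0 -mulrSr mulrnAC gN mul0rn.
    have -> : h *+ n = - h by apply/eqP; rewrite -addr_eq0 -mulrSr (ch_tors chH).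
    by rewrite [h + _ - _ - _]addrC !addrA addNr add0r.
  have [Hhn chihn] := ch_mulrn n Hh.
  have Hgj : H (g *+ (j + n * j1)) by rewrite eqg; exact: (chD chH).
  have := tg _ Hgj; rewrite eqg (ch_add chH) // chihn mulrnDr mulnC mulrnA => eqt.
  have oppN (u : 'I_N) : u *+ n = - u.
    by apply/eqP; rewrite -addr_eq0 -mulrSr Zp_mulrN.
  move: eqt; rewrite !oppN => /eqP; rewrite subr_eq addrAC eq_sym subr_eq addrC => /eqP ->.
  by [].
exists H', chi'; split.
- split=> [|x y [[h j] [/= Hh ->]] [[h' j'] [/= Hh' ->]]|x [[h j] [/= Hh ->]]|
           x y [[h j] [/= Hh ->]] [[h' j'] [/= Hh' ->]]].
  + by exists (0, 0%N); split; [exact: (ch0 chH) | rewrite addr0].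
  + by exists (h + h', (j + j')%N); split; [exact: (chD chH) | rewrite mulrnDr addrACA].
  + by rewrite mulrnDl (ch_tors chH) // mulrnAC gN mul0rn addr0.
  by rewrite addrACA -mulrnDr !chi'E ?(ch_add chH) ?mulrnDr 1?addrACA //; exact: (chD chH).
- by move=> x Hx; exists (x, 0%N); rewrite /= addr0.
- by exists (0, 1%N); split; [exact: (ch0 chH) | rewrite add0r].
- by move=> x Hx; rewrite -[in LHS](addr0 x) -(mulr0n g) chi'E // addr0.
by rewrite -[g in LHS]add0r -[g in LHS]mulr1n chi'E ?ch_zero ?add0r //; exact: (ch0 chH).
Qed.

End OneCharacter.

(** The divisibility behind the self-injectivity of Z/N; it supplies the value at a new generator of
    order m modulo H. *)
Lemma Zp_div (u : 'I_N) m q : (m * q = N)%N -> u *+ q = 0 -> exists t : 'I_N, t *+ m = u.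
Proof.
move=> mq; rewrite Zp_mulrn => /(congr1 val) /= /eqP; rewrite -/(dvdn N (u * q)) => dN.
have q_gt0 : (0 < q)%N by have := ltn0Sn n; rewrite -mq muln_gt0; case/andP.
have /dvdnP[v uE] : (m %| u)%N by rewrite -(dvdn_pmul2r q_gt0) mq.
exists (inord v); rewrite Zp_mulrn; apply/val_inj => /=.
have m_gt0 : (0 < m)%N by have := ltn0Sn n; rewrite -mq muln_gt0; case/andP.
rewrite inordK; first by rewrite -uE modn_small.
by apply: leq_trans (ltn_ord u); rewrite ltnS uE leq_pmulr.
Qed.

Lemma torsion_order (H : G -> Prop) g : H 0 -> (forall x y, H x -> H y -> H (x + y)) ->
  (forall x, H x -> H (- x)) -> g *+ N = 0 ->
  exists m q, [/\ (m * q = N)%N, H (g *+ m) & forall j, H (g *+ j) -> (m %| j)%N].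
Proof.
move=> H0 HD HN gN.
have ex : exists m, (0 < m)%N && `[< H (g *+ m) >] by exists N; rewrite gN; apply/asboolP.
case: (ex_minnP ex) => m /andP[m_gt0 /asboolP Hm] minm.
have HX x j : H x -> H (x *+ j).
  by move=> Hx; elim: j => // j IHj; rewrite mulrS; exact: HD.
have dvdm j : H (g *+ j) -> (m %| j)%N.
  move=> Hj; rewrite /dvdn eqn0Ngt; apply/negP => r_gt0.
  have : (m <= j %% m)%N.
    apply: minm; rewrite r_gt0; apply/asboolP.
    have -> : g *+ (j %% m) = g *+ j - g *+ m *+ (j %/ m).
      by rewrite {2}(divn_eq j m) mulrnDr mulnC mulrnA addrAC subrr add0r.
    by apply/HD/HN/HX.
  by rewrite leqNgt ltn_pmod.
have /dvdnP[q Nq] : (m %| N)%N by apply: dvdm; rewrite gN.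
by exists m, q; split=> //; rewrite mulnC.
Qed.

(** A faithful character of the cyclic group of g0 is extended through the finitely many elements of
    s, one at a time. *)
Lemma character_separates (s : seq G) g0 :
  (forall g, g \in s -> g *+ N = 0) -> g0 *+ N = 0 -> g0 <> 0 ->
  exists H chi, [/\ character_on H chi, forall g, g \in s -> H g, H g0 & chi g0 != 0].
Proof.
move=> sN g0N g0n0; elim: s sN => [_|g s IHs sN].
  pose H (x : G) := x = 0.
  have chH : character_on H (fun=> 0).
    by split=> // [x y -> ->|x ->|x y _ _]; rewrite ?mul0rn ?addr0.
  have [||m [q [mq Hm dvdm]]] := @torsion_order H g0 erefl _ _ g0N.
  - by move=> x y -> ->; rewrite /H addr0.
  - by move=> x ->; rewrite /H oppr0.
  have m_gt1 : (1 < m)%N.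
    rewrite ltnNge; apply/negP; case: m mq Hm {dvdm} => [|[|//]] mq Hm _ //.
  have q_gt0 : (0 < q)%N by have := ltn0Sn n; rewrite -mq muln_gt0; case/andP.
  have ltqN : (q < N)%N by rewrite -mq ltn_Pmull.
  (* g0 has order m, and q = N / m has order m in Z/N. *)
  have [|H' [chi' [ch' _ Hg _ chi'g]]] := @character_extend H _ chH g0 (inZp q) g0N.
    move=> j /dvdm/dvdnP[i ->]; rewrite Zp_mulrn; apply/val_inj => /=.
    by rewrite modnMml mulnCA (mulnC q) mq modnMl.
  exists H', chi'; split=> //; rewrite chi'g -val_eqE /= modn_small //.
  by rewrite -lt0n.
have [|H [chi [chH Hs Hg0 chig0]]] := IHs.
  by move=> h hs; apply: sN; rewrite inE hs orbT.
have gN : g *+ N = 0 by apply: sN; rewrite mem_head.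
have [m [q [mq Hm dvdm]]] := torsion_order (ch0 chH) (chD chH) (ch_opp chH) gN.
have [t tE] : exists t : 'I_N, t *+ m = chi (g *+ m).
  apply: (Zp_div mq); have [_ <-] := ch_mulrn chH q Hm.
  by rewrite -mulrnA mq gN (ch_zero chH).
have [|H' [chi' [ch' HH' Hg chi'E _]]] := @character_extend H _ chH g t gN.
  move=> j /dvdm/dvdnP[i ->]; rewrite mulnC !mulrnA tE.
  by have [] := ch_mulrn chH i Hm.
exists H', chi'; split=> //; [|exact: HH'|by rewrite chi'E].
by move=> h; rewrite inE => /predU1P[->//|/Hs/HH'].
Qed.

End Characters.

Section CharacterGrading.
Variables (k R : comPzRingType) (iota : {rmorphism k -> R}).
Variables (G : zmodType) (M : G -> R -> Prop) (s : seq G) (comp : G -> R -> R).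
Hypotheses (grM : is_grading iota M) (gcM : graded_components iota M s comp).
Variables (n : nat) (H : G -> Prop) (chi : G -> 'I_n.+1).
Hypotheses (chH : character_on H chi) (Hs : forall g, g \in s -> H g).

Definition char_part (a : nat) (r : R) : R :=
  \sum_(g <- s | chi g == a :> nat) comp g r.

Lemma char_part_homog g a r : M g r -> H g ->
  char_part a r = if chi g == a :> nat then r else 0.
Proof.
move=> Mr Hg; have [gs|gs] := boolP (g \in s); last first.
  have r0 : r = 0 by rewrite -((gc_memP gcM g r).1 Mr) (gc_out gcM).
  rewrite r0 /char_part big1 ?if_same // => h _; exact: (gc0 gcM).
rewrite /char_part; case: eqP => [cg|ncg].
  rewrite -big_filter (bigD1_seq g) ?filter_uniq ?(gc_uniq gcM) ?mem_filter ?cg ?eqxx //=.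
  rewrite (gc_homog gcM _ Mr) eqxx big1 ?addr0 // => h neqhg.
  by rewrite (gc_homog gcM _ Mr) (negPf neqhg).
rewrite big1 // => h /eqP ch; rewrite (gc_homog gcM _ Mr); case: eqP => // eqhg.
by case: ncg; rewrite -ch eqhg.
Qed.

Lemma char_partD a x y : char_part a (x + y) = char_part a x + char_part a y.
Proof. by rewrite -big_split; apply: eq_bigr => g _; rewrite (gcD gcM). Qed.

Lemma char_part_big a (I : eqType) (t : seq I) (P : pred I) (x : I -> R) :
  char_part a (\sum_(i <- t | P i) x i) = \sum_(i <- t | P i) char_part a (x i).
Proof.
elim/big_rec2: _ => [|i y1 y2 _ <-]; rewrite ?char_partD //.
by rewrite /char_part big1 // => g _; rewrite (gc0 gcM).
Qed.

Lemma char_grading : cyclic_grading (fun c => exists d, c = iota d) n.+1 char_part.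
Proof.
have [_ _ _ M1 MM] := grM.
split.
- exact: char_partD.
- move=> a c x [d ->]; rewrite mulr_sumr; apply: eq_bigr => g _; exact: (gcZ gcM).
- move=> a b x an bn; rewrite {2}/char_part char_part_big.
  case: eqP => [->|neqab].
    rewrite [LHS]big_seq_cond [RHS]big_seq_cond.
    apply: eq_bigr => g /andP[/Hs Hg cb]; by rewrite (char_part_homog _ (gc_mem gcM _ _) Hg) cb.
  rewrite big_seq_cond big1 // => g /andP[/Hs Hg /eqP cb].
  by rewrite (char_part_homog _ (gc_mem gcM _ _) Hg) cb; case: eqP neqab => // ->.
- move=> x; rewrite -[RHS](gc_sum gcM) /char_part.
  rewrite (exchange_big_dep xpredT) //=; apply: eq_bigr => g _.
  rewrite (bigD1 (chi g)) //= big1 ?addr0 // => i /andP[/eqP/val_inj <-].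
  by rewrite eqxx.
- by rewrite (char_part_homog _ M1 (ch0 chH)) (ch_zero chH).
move=> a b x y an bn; rewrite {2 4}/char_part mulr_suml char_part_big.
rewrite big_seq_cond [RHS]big_seq_cond.
apply: eq_bigr => g /andP[/Hs Hg /eqP ca]; rewrite mulr_sumr char_part_big.
rewrite big_seq_cond [RHS]big_seq_cond.
apply: eq_bigr => h /andP[/Hs Hh /eqP cb].
rewrite (char_part_homog _ (MM _ _ _ _ (gc_mem gcM _ _) (gc_mem gcM _ _)) (chD chH Hg Hh)).
by rewrite (ch_add chH) //= ca cb eqxx.
Qed.
End CharacterGrading.

(** For a prime l other than p, the l-torsion is infinitely p-divisible, hence zero. Regularity of
    all positive integers is wanted because [qpoly_reduced] divides by arbitrary factors j + 1. *)
Lemma separated_torsion_free (R : comPzRingType) p : prime p ->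
  p_separated R p -> nat_regular R p -> forall m, (0 < m)%N -> nat_regular R m.
Proof.
move=> p_pr sepp regp m; have [j] := ubnP m; elim: j m => // j IHj m /ltnSE lemj m_gt0 x mx0.
have [m1|m_gt1] := leqP m 1.
  by move: mx0; rewrite (_ : m = 1%N) ?mul1r //; apply/eqP; rewrite eqn_leq m1.
have /dvdnP[q mE] := pdiv_dvd m; have l_pr := pdiv_prime m_gt1.
have q_gt0 : (0 < q)%N by move: m_gt0; rewrite mE muln_gt0; case/andP.
apply: (IHj q) => //; first by apply: leq_trans lemj; rewrite [X in (_ < X)%N]mE ltn_Pmulr // prime_gt1.
have : (pdiv m)%:R * (q%:R * x) = 0 by rewrite mulrA -natrM mulnC -mE.
move: (pdiv m) (q%:R * x) l_pr => l y l_pr ly0.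
have [eqlp|neqlp] := eqVneq l p; first by apply: regp; rewrite -eqlp.
(* p acts invertibly on the l-torsion *)
have [a b ab _] := @egcdnP p l (prime_gt0 p_pr).
have {}ab : (a * p = b * l + 1)%N.
  rewrite ab; congr (_ + _)%N; apply/eqP; rewrite -/(coprime p l) prime_coprime //.
  by rewrite dvdn_prime2 // eq_sym.
have yE : y = p%:R * (a%:R * y).
  rewrite mulrA -natrM mulnC ab natrD natrM mulrDl -mulrA ly0 mulr0 add0r.
  by rewrite mul1r.
apply: sepp => i; exists (a%:R ^+ i * y); elim: i => [|i IHi]; first by rewrite expn0 expr0 !mul1r.
rewrite {1}IHi {1}yE expnS natrM exprS; ring.
Qed.

(** * Commutation of arbitrary e-torsion gradings *)

Section GradingsCommute.
Variables (k R : comPzRingType) (iota : {rmorphism k -> R}) (e : steinitz).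
Hypotheses (noek : noetherian k) (redR : reduced R) (genR : kmod_fin_gen iota).
Hypothesis sepR : forall p, prime_dvd_st p e -> p_separated R p /\ nat_regular R p.

Lemma e_torsion_exponent (G : zmodType) (s : seq G) : e_torsion e G ->
  exists N, [/\ (0 < N)%N, forall g, g \in s -> g *+ N = 0 &
    forall p, prime p -> (p %| N)%N -> prime_dvd_st p e].
Proof.
move=> torG; elim: s => [|g s [N [N_gt0 sN Ne]]].
  exists 1%N; split=> // p p_pr; rewrite dvdn1 => /eqP p1; by rewrite p1 in p_pr.
have [m [[m_gt0 gm _] [_ me]]] := torG g.
exists (m * N)%N; split=> [|h|p p_pr]; first by rewrite muln_gt0 m_gt0.
  rewrite inE => /predU1P[->|/sN hN]; first by rewrite mulrnA gm mul0rn.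
  by rewrite mulnC mulrnA hN mul0rn.
rewrite Euclid_dvdM // => /orP[pm|/Ne//]; last exact.
split=> //; have := me _ p_pr; case: (e p) => // j; apply: leq_trans.
by rewrite logn_gt0 mem_primes p_pr m_gt0.
Qed.

Section TwoGradings.
Variables (G D : zmodType) (M : G -> R -> Prop) (T : D -> R -> Prop).
Hypotheses (torG : e_torsion e G) (torD : e_torsion e D).
Hypotheses (grM : is_grading iota M) (grT : is_grading iota T).
Variables (s : seq G) (t : seq D) (comp : G -> R -> R) (comp' : D -> R -> R).
Hypotheses (gcM : graded_components iota M s comp)
  (gcT : graded_components iota T t comp').

(** If F carried something of degree g into another degree h, a character nontrivial on h - g would
    put g and h into different parts, and F preserves the parts. *)
Let separate (X : zmodType) (MX : X -> R -> Prop) (u : seq X) (cX : X -> R -> R) n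
    (F : R -> R) :
  is_grading iota MX -> graded_components iota MX u cX ->
  (forall g, g \in u -> g *+ n.+1 = 0) -> (forall x y, F (x + y) = F x + F y) ->
  (forall H (chi : X -> 'I_n.+1) a r, character_on H chi -> (forall g, g \in u -> H g) ->
     (a < n.+1)%N -> F (char_part u cX chi a r) = char_part u cX chi a (F r)) ->
  forall g r, F (cX g r) = cX g (F r).
Proof.
move=> grX gcX uN FD Fchar g r; apply: (gc_commute gcX) => // {}g h {}r Mr gu neqhg.
have [hu|/(gc_out gcX)//] := boolP (h \in u).
have [||H [chi [chH Hu Hgh chigh]]] := @character_separates X n u (h - g) uN.
- by rewrite mulrnBl !uN // subrr.
- by apply/eqP; rewrite subr_eq0.
have neqchi : chi h != chi g.
  have -> : chi h = chi (h - g) + chi g by rewrite -(ch_add chH) ?subrK //; exact: Hu.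
  by rewrite -subr_eq0 addrK.
have gr : char_part u cX chi (chi g) r = r.
  by rewrite (char_part_homog gcX chi _ Mr (Hu _ gu)) eqxx.
rewrite -{1}gr (Fchar H) // /char_part (gc_big gcX) big1 // => f /eqP cf.
rewrite (gc_comp gcX); case: eqP => // hf.
by case/eqP: neqchi; apply/val_inj; rewrite hf.
Qed.

Lemma components_commute g d r : comp g (comp' d r) = comp' d (comp g r).
Proof.
have [N1 [N1_gt0 sN1 N1e]] := e_torsion_exponent s torG.
have [N2 [N2_gt0 tN2 N2e]] := e_torsion_exponent t torD.
pose n := (N1 * N2).-1.
have nE : n.+1 = (N1 * N2)%N by rewrite prednK // muln_gt0 N1_gt0.
have sN x : x \in s -> x *+ n.+1 = 0 by rewrite nE mulrnA => /sN1 ->; rewrite mul0rn.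
have tN x : x \in t -> x *+ n.+1 = 0 by rewrite nE mulnC mulrnA => /tN2 ->; rewrite mul0rn.
have Ne p : prime p -> (p %| n.+1)%N -> prime_dvd_st p e.
  by move=> p_pr; rewrite nE Euclid_dvdM // => /orP[/N1e|/N2e]; apply.
have commute_chars H (chi : G -> 'I_n.+1) H' (chi' : D -> 'I_n.+1) a b x :
    character_on H chi -> (forall g, g \in s -> H g) ->
    character_on H' chi' -> (forall g, g \in t -> H' g) ->
    (a < n.+1)%N -> (b < n.+1)%N ->
    char_part s comp chi a (char_part t comp' chi' b x) =
    char_part t comp' chi' b (char_part s comp chi a x).
  move=> chH Hs chH' Ht an bn.
  have cycP := char_grading grM gcM chH Hs; have cycQ := char_grading grT gcT chH' Ht.
  (* For exponent 1 no prime is at hand to give torsion-freeness, but then both gradings are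
     trivial. *)
  have [n0|n_gt0] := posnP n.
    have triv (P : nat -> R -> R) i y : cyclic_grading (fun c => exists d, c = iota d) n.+1 P ->
        (i < n.+1)%N -> P i y = y.
      by move=> cyc; rewrite {1}n0 ltnS leqn0 => /eqP->; move: (cyc_sum cyc y); rewrite n0 big_ord1.
    by rewrite !(triv _ _ _ cycP) // !(triv _ _ _ cycQ).
  have p_pr : prime (pdiv n.+1) by exact: pdiv_prime.
  have [sepp regp] := sepR (Ne _ p_pr (pdiv_dvd _)).
  apply: (@cyclic_gradings_commute_noetherian k R iota n.+1 n.+1 n.+1 _ _ a b x noek redR genR
    (ltn0Sn n) _ _ (dvdnn _) (dvdnn _) cycP cycQ an bn).
    exact: separated_torsion_free p_pr sepp regp.
  by move=> p p'_pr pn; have [] := sepR (Ne _ p'_pr pn).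
symmetry; apply: (separate grM gcM sN) => [|H chi a x chH Hs an]; first exact: (gcD gcT).
symmetry; apply: (separate grT gcT tN) => [|H' chi' b y chH' Ht bn].
  exact: (char_partD gcM).
exact: commute_chars chH Hs chH' Ht an bn.
Qed.
End TwoGradings.
End GradingsCommute.

(** * Common refinements *)

Lemma nat_dvd_st_dvd d m e : (d %| m)%N -> nat_dvd_st m e -> nat_dvd_st d e.
Proof.
move=> dm [m_gt0 me]; split=> [|p p_pr]; first exact: dvdn_gt0 dm.
by have := me p p_pr; case: (e p) => // n; apply: leq_trans; exact: dvdn_leq_log.
Qed.

Lemma nat_dvd_st_lcm a b e : nat_dvd_st a e -> nat_dvd_st b e -> nat_dvd_st (lcmn a b) e.
Proof.
move=> [a_gt0 ae] [b_gt0 be]; split=> [|p p_pr]; first by rewrite lcmn_gt0 a_gt0.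
have := be p p_pr; have := ae p p_pr; case: (e p) => // n an bn.
by rewrite logn_lcm // geq_max an.
Qed.

(** Any annihilating multiple in place of the exact order, a form that passes to sums through
    lcm. *)
Definition torsion_dvd (e : steinitz) (G : zmodType) (g : G) : Prop :=
  exists2 m, nat_dvd_st m e & g *+ m = 0.

Lemma e_torsionP e (G : zmodType) : e_torsion e G <-> forall g : G, torsion_dvd e g.
Proof.
split=> torG g; first by have [m [[_ gm _] me]] := torG g; exists m.
have [m me gm] := torG g; have [m_gt0 _] := me.
have ex : exists m, (0 < m)%N && (g *+ m == 0) by exists m; rewrite m_gt0 gm eqxx.
case: (ex_minnP ex) => d /andP[d_gt0 /eqP gd] mind; exists d; split.
  by split=> // j j_gt0 /eqP gj; apply: mind; rewrite j_gt0.
apply: nat_dvd_st_dvd me; rewrite /dvdn eqn0Ngt; apply/negP => r_gt0.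
have : (d <= m %% d)%N.
  apply: mind; rewrite r_gt0; apply/eqP; move: gm.
  by rewrite {1}(divn_eq m d) mulrnDr mulnC mulrnA gd mul0rn add0r.
by rewrite leqNgt ltn_pmod.
Qed.

Lemma torsion_dvdD e (G : zmodType) (g h : G) :
  torsion_dvd e g -> torsion_dvd e h -> torsion_dvd e (g + h).
Proof.
move=> [a ae ga] [b be hb]; exists (lcmn a b); first exact: nat_dvd_st_lcm.
have /dvdnP[q qE] := dvdn_lcml a b; have /dvdnP[q' q'E] := dvdn_lcmr a b.
by rewrite mulrnDl {1}qE q'E mulnC mulrnA ga mul0rn mulnC mulrnA hb mul0rn addr0.
Qed.

Section Maximal.
Variables (k R : comPzRingType) (iota : {rmorphism k -> R}) (e : steinitz).
Hypotheses (noek : noetherian k) (redR : reduced R) (genR : kmod_fin_gen iota).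
Hypothesis sepR : forall p, prime_dvd_st p e -> p_separated R p /\ nat_regular R p.

Definition e_grading (G : zmodType) (M : G -> R -> Prop) : Prop :=
  e_torsion e G /\ is_grading iota M.

Definition joint (G D : zmodType) (M : G -> R -> Prop) (T : D -> R -> Prop)
    (x : G * D) (r : R) : Prop := M x.1 r /\ T x.2 r.

Lemma trivial_grading : e_grading (fun (_ : 'I_1) (_ : R) => True).
Proof.
split.
  apply/e_torsionP => g; exists 1%N; first by split=> // p _; case: (e p) => //; rewrite logn1.
  by rewrite [g]ord1 mulr1n.
split=> // [r|s x us _ sum0 g gs].
  by exists [:: 0], (fun=> r); rewrite big_seq1.
move: sum0; rewrite (bigD1_seq g) //= big1 ?addr0 // => h.
by rewrite [h]ord1 [g]ord1 eqxx.
Qed.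

Section Joint.
Variables (G D : zmodType) (M : G -> R -> Prop) (T : D -> R -> Prop).
Hypotheses (egM : e_grading M) (egT : e_grading T).
Variables (s : seq G) (t : seq D) (comp : G -> R -> R) (comp' : D -> R -> R).
Hypotheses (gcM : graded_components iota M s comp)
  (gcT : graded_components iota T t comp').

Let comm g d r : comp g (comp' d r) = comp' d (comp g r).
Proof.
by apply: (components_commute noek redR genR sepR) gcM gcT _ _ _;
  [exact: egM.1 | exact: egT.1 | exact: egM.2 | exact: egT.2].
Qed.

Let jcomp (x : G * D) r := comp' x.2 (comp x.1 r).

Lemma joint_components :
  graded_components iota (joint M T) [seq (g, d) | g <- s, d <- t] jcomp.
Proof.
split.
- by apply: allpairs_uniq; rewrite ?(gc_uniq gcM) ?(gc_uniq gcT) // => -[? ?] [? ?].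
- move=> x r; split; last exact: (gc_mem gcT).
  by rewrite /jcomp -comm; exact: (gc_mem gcM).
- move=> r; rewrite big_allpairs -[RHS](gc_sum gcM); apply: eq_bigr => g _.
  exact: (gc_sum gcT (comp g r)).
- move=> [g d] r [g' d'] [/= Mr Tr]; rewrite /jcomp /= (gc_homog gcM _ Mr) xpair_eqE.
  by case: eqP => _; rewrite ?(gc_homog gcT _ Tr) ?(gc0 gcT).
- by move=> x y z; rewrite /jcomp (gcD gcM) (gcD gcT).
- by move=> x c y; rewrite /jcomp (gcZ gcM) (gcZ gcT).
move=> [g d] r; rewrite /jcomp /=; have [gs|/(gc_out gcM)->] := boolP (g \in s); last first.
  by rewrite (gc0 gcT).
have [dt|/(gc_out gcT)->//] := boolP (d \in t).
by move=> /negP[]; exact: allpairs_f.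
Qed.

Lemma joint_grading : e_grading (joint M T).
Proof.
have gcJ := joint_components.
case: egM egT => torG [kM _ _ M1 MM] [torD [kT _ _ T1 TM]]; split.
  apply/e_torsionP => -[g d].
  have -> : (g, d) = (g, 0) + (0, d) :> G * D.
    by apply/eqP; rewrite xpair_eqE /= addr0 add0r !eqxx.
  apply: torsion_dvdD.
    have [m me gm] := (e_torsionP e G).1 torG g; exists m => //.
    have -> : (g, 0) *+ m = (g *+ m, 0 : D).
      by elim: m {me gm} => // m IHm; rewrite !mulrS IHm; congr pair; exact: addr0.
    by rewrite gm.
  have [m me dm] := (e_torsionP e D).1 torD d; exists m => //.
  have -> : (0, d) *+ m = (0 : G, d *+ m).
    by elim: m {me dm} => // m IHm; rewrite !mulrS IHm; congr pair; exact: addr0.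
  by rewrite dm.
split.
- move=> [g d]; have [M0 MD MZ] := kM g; have [T0 TD TZ] := kT d.
  by split=> [|x y [? ?] [? ?]|c x [? ?]]; split; auto.
- move=> r; exists [seq (g, d) | g <- s, d <- t], (jcomp^~ r); split; first exact: (gc_uniq gcJ).
  by split; [move=> g; exact: (gc_mem gcJ) | rewrite (gc_sum gcJ)].
- move=> u x uu Jx sum0 g gu; have := congr1 (jcomp g) sum0.
  rewrite (gc0 gcJ) (gc_big gcJ) (bigD1_seq g) //= (gc_homog gcJ _ (Jx g)) eqxx.
  rewrite big1 ?addr0 // => h neqhg; rewrite (gc_homog gcJ _ (Jx h)).
  by rewrite eq_sym (negPf neqhg).
- by split.
by move=> [g d] [g' d'] a b [? ?] [? ?]; split; [exact: MM | exact: TM].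
Qed.
End Joint.

Lemma joint_e_grading (G D : zmodType) (M : G -> R -> Prop) (T : D -> R -> Prop) :
  e_grading M -> e_grading T -> e_grading (joint M T).
Proof.
move=> egM egT; have [s [comp gcM]] := grading_components egM.2 genR.
have [t [comp' gcT]] := grading_components egT.2 genR.
exact: joint_grading gcM gcT.
Qed.

Definition unsplittable (U : R -> Prop) : Prop :=
  forall (D : zmodType) (T : D -> R -> Prop), e_grading T ->
  exists d, forall r, U r -> T d r.

Definition refinable (U : R -> Prop) : Prop :=
  exists (H : zmodType) (T : H -> R -> Prop),
    e_grading T /\ forall h, unsplittable (fun r => U r /\ T h r).

Lemma unsplittableS (U U' : R -> Prop) : (forall r, U r -> U' r) -> unsplittable U' -> unsplittable U.
Proof. by move=> sUU uU' D T egT; have [d dP] := uU' D T egT; exists d => r /sUU/dP. Qed.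

Lemma unsplittable0 (U : R -> Prop) : (forall r, U r -> r = 0) -> unsplittable U.
Proof.
move=> U0 D T [_ [kT _ _ _ _]]; exists 0 => r /U0->.
by case: (kT 0).
Qed.

(** Subsets of unsplittable sets are unsplittable, so the joint grading of finitely many refinements
    serves all the U i at once. *)
Lemma refinable_seq (I : eqType) (U : I -> R -> Prop) (t : seq I) :
  (forall i, i \in t -> refinable (U i)) ->
  exists (H : zmodType) (T : H -> R -> Prop),
    e_grading T /\ forall i h, i \in t -> unsplittable (fun r => U i r /\ T h r).
Proof.
elim: t => [_|i t IHt refU].
  by exists _, (fun (_ : 'I_1) (_ : R) => True); split; first exact: trivial_grading.
have [|H [T [egT HT]]] := IHt; first by move=> j jt; apply: refU; rewrite inE jt orbT.
have [|H' [T' [egT' HT']]] := refU i; first exact: mem_head.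
exists _, (joint T T'); split; first exact: joint_e_grading.
move=> j h; rewrite inE => /predU1P[->|jt].
  by apply: unsplittableS (HT' h.2) => r [? []].
by apply: unsplittableS (HT j h.1 jt) => r [? []].
Qed.

(* Among the components that are not refinable, one with a maximal complement W
   can only be split into refinable pieces. *)
Lemma component_refinable (G : zmodType) (M : G -> R -> Prop) g :
  e_grading M -> refinable (M g).
Proof.
move=> egM0; apply: contrapT => nref0.
pose F W := exists (G : zmodType) (M : G -> R -> Prop) s comp g,
  [/\ e_grading M, graded_components iota M s comp, ~ refinable (M g) &
      W = (fun r => comp g r = 0)].
have accF : ascending_stable F.
  apply: ascending_stable_sub (noetherian_ksubmod noek genR) => _ [G' [M' [s [comp [h [_ gcM _ ->]]]]]].
  split=> [|x y|c x]; first exact: (gc0 gcM).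
    by rewrite (gcD gcM) => -> ->; rewrite addr0.
  by rewrite (gcZ gcM) => ->; rewrite mulr0.
have [|W] := ascending_stable_maximal accF.
  have [s [comp gcM]] := grading_components egM0.2 genR.
  by eexists; exists G, M, s, comp, g; split.
move: (G) (M) (g) => {G M g egM0 nref0} _ _ _ [G [M [s [comp [g [egM gcM nref ->]]]]]] maxW.
apply: nref.
have [uM|nuM] := pselect (unsplittable (M g)).
  by exists G, M; split=> // h; apply: unsplittableS uM => r [].
have [D [T [egT splitT]]] : exists (D : zmodType) (T : D -> R -> Prop),
    e_grading T /\ forall d, exists2 r, M g r & ~ T d r.
  apply: contrapT => nsplit; apply: nuM => D T egT; apply: contrapT => nod.
  apply: nsplit; exists D, T; split=> // d; apply: contrapT => nor; apply: nod.
  by exists d => r Mr; apply: contrapT => nTr; apply: nor; exists r.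
have [t [comp' gcT]] := grading_components egT.2 genR.
have comm x d r : comp x (comp' d r) = comp' d (comp x r).
  exact: (components_commute noek redR genR sepR egM.1 egT.1 egM.2 egT.2 gcM gcT).
have refd d : refinable (fun r => M g r /\ T d r).
  (* The kernel of the projection to this smaller piece contains that of [comp g]; by maximality
     they agree, which forces M g into T d, against the choice of T. *)
  apply: contrapT => nrefd.
  have FW : F (fun r => comp' d (comp g r) = 0).
    exists _, (joint M T), [seq (x, y) | x <- s, y <- t].
    exists (fun x r => comp' x.2 (comp x.1 r)), (g, d).
    split; [exact: joint_e_grading egM egT |
      exact: (@joint_components _ _ _ _ egM egT s t comp comp' gcM gcT) |exact: nrefd | by []].
  have [r Mr nTr] := splitT d; apply: nTr.
  have gr := (gc_memP gcM g r).1 Mr.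
  have d0 : comp g (r - comp' d r) = 0.
    apply: (maxW _ FW) => [x ->|]; first exact: (gc0 gcT).
    rewrite -mulN1r -(rmorphN1 iota) (gcD gcM) (gcZ gcM) comm gr (gcD gcT) (gcZ gcT).
    by rewrite (gc_comp gcT) eqxx rmorphN1 mulN1r subrr.
  have /eqP : r - comp' d r = 0.
    move: d0; rewrite -mulN1r -(rmorphN1 iota) (gcD gcM) (gcZ gcM) comm gr.
    by rewrite rmorphN1 mulN1r.
  by rewrite subr_eq0 => /eqP->; exact: (gc_mem gcT).
have [H [T' [egT' HT']]] := refinable_seq (t := t) (fun d _ => refd d).
exists _, (joint T T'); split; first exact: joint_e_grading.
move=> [d h]; have [dt|dt] := boolP (d \in t).
  by apply: unsplittableS (HT' d h dt) => r [? []].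
apply: unsplittable0 => r [_ [/= Tr _]].
by rewrite -((gc_memP gcT d r).1 Tr) (gc_out gcT).
Qed.

Theorem exists_unsplittable_grading : exists (H : zmodType) (T : H -> R -> Prop),
  e_grading T /\ forall h, unsplittable (T h).
Proof.
have [H [T [egT HT]]] := component_refinable 0 trivial_grading.
by exists H, T; split=> // h; apply: unsplittableS (HT h).
Qed.
End Maximal.

(** * The universal grading *)

Lemma zmod_quotient (V : zmodType) (K : V -> Prop) :
  K 0 -> (forall x y, K x -> K y -> K (x - y)) ->
  exists (Q : zmodType) (f : {additive V -> Q}),
    (forall q, exists v, f v = q) /\ forall v, f v = 0 <-> K v.
Proof.
move=> K0 KB; pose p : pred V := fun v => `[< K v >].
have zc : zmod_closed p.
  by split=> [|x y /asboolP Kx /asboolP Ky]; apply/asboolP => //; exact: KB.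
pose pc := GRing.isZmodClosed.Build V p zc.
pose I : zmodClosed V := HB.pack p pc.
exists (Quotient.quot I : zmodType), \pi_(Quotient.quot I).
split=> [q|v]; first by exists (repr q); exact: reprK.
have piE0 : \pi_(Quotient.quot I) v = 0 <-> v \in I.
  rewrite -(raddf0 \pi_(Quotient.quot I)) -[v in v \in I]subr0 Quotient.idealrBE.
  by split=> /eqP.
by rewrite piE0; split=> /asboolP.
Qed.

Lemma additive_pack (V W : zmodType) (f : V -> W) :
  (forall x y, f (x + y) = f x + f y) -> exists g : {additive V -> W}, g =1 f.
Proof.
move=> fD; have zm : zmod_morphism f.
  by move=> x y; apply/eqP; rewrite eq_sym subr_eq -fD subrK.
pose fm := GRing.isZmodMorphism.Build V W f zm.
pose g : {additive V -> W} := HB.pack f fm.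
by exists g.
Qed.

Section Universal.
Variables (k R : comPzRingType) (iota : {rmorphism k -> R}) (e : steinitz).
Hypotheses (redR : reduced R) (genR : kmod_fin_gen iota).
Variables (H : zmodType) (T : H -> R -> Prop).
Hypotheses (egT : e_grading iota e T) (unsT : forall h, unsplittable iota e (T h)).

Lemma degree_unique (D : zmodType) (S : D -> R -> Prop) d d' r :
  is_grading iota S -> S d r -> S d' r -> r <> 0 -> d = d'.
Proof.
move=> grS Sd Sd' r0; have [s [comp gcS]] := grading_components grS genR.
have := gc_homog gcS d Sd'; rewrite (gc_homog gcS d Sd) eqxx.
by case: eqP.
Qed.

Definition coarsens (D : zmodType) (S : D -> R -> Prop) (f : H -> D) : Prop :=
  forall h r, T h r -> S (f h) r.

Lemma exists_coarsens (D : zmodType) (S : D -> R -> Prop) :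
  e_grading iota e S -> exists f, coarsens S f.
Proof. by move=> egS; have [f fP] := choice (fun h => unsT h egS); exists f. Qed.

Section CoarseDegrees.
Variables (D : zmodType) (S : D -> R -> Prop) (f : H -> D).
Hypotheses (grS : is_grading iota S) (fS : coarsens S f).

Lemma coarsens0 : (1 : R) <> 0 -> f 0 = 0.
Proof.
have [_ _ _ S1 _] := grS; have [_ _ _ T1 _] := egT.2.
by apply: degree_unique grS (fS T1) S1.
Qed.

Lemma coarsensD g h a b : T g a -> T h b -> a * b <> 0 -> f (g + h) = f g + f h.
Proof.
have [_ _ _ _ SM] := grS; have [_ _ _ _ TM] := egT.2.
move=> Ta Tb; apply: degree_unique grS (fS (TM _ _ _ _ Ta Tb)) _.
exact: SM (fS Ta) (fS Tb).
Qed.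

(** f need not be a homomorphism, but reducedness keeps a^n nonzero, and the degree of a^n can be
    computed in two ways. *)
Lemma coarsens_torsion g a n : T g a -> a <> 0 -> g *+ n = 0 -> f g *+ n = 0.
Proof.
have [_ _ _ S1 SM] := grS; have [_ _ _ T1 TM] := egT.2.
move=> Ta a0 gn; have an0 : a ^+ n <> 0 by move/redR.
have Tn m : T (g *+ m) (a ^+ m).
  by elim: m => [|m IHm]; rewrite ?mulr0n ?expr0 // mulrS exprS; exact: TM.
have Sn m : S (f g *+ m) (a ^+ m).
  by elim: m => [|m IHm]; rewrite ?mulr0n ?expr0 // mulrS exprS; apply: SM (fS Ta) _.
have one0 : (1 : R) <> 0 by move=> R0; apply: a0; rewrite -[a]mul1r R0 mul0r.
rewrite -(coarsens0 one0); apply: degree_unique grS (Sn n) _ an0.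
by rewrite -gn; exact/fS.
Qed.

End CoarseDegrees.

Theorem exists_universal_grading :
  exists (G : zmodType) (M : G -> R -> Prop), universal_grading iota e M.
Proof.
have [torT grT] := egT; have [s [comp gcT]] := grading_components grT genR.
have [kT _ _ T1 TM] := grT.
(* Only degrees with a nonzero component are kept: elsewhere the values of a coarsening are
   arbitrary, and [ev] must not see them. *)
pose I := [seq h <- s | `[< exists2 r, T h r & r <> 0 >]].
have uI : uniq I by rewrite filter_uniq ?(gc_uniq gcT).
pose n := size I; pose pt (i : 'I_n) := nth 0 I i.
have pt_nz i : exists2 r, T (pt i) r & r <> 0.
  by have := mem_nth 0 (ltn_ord i); rewrite mem_filter => /andP[/asboolP].
have pt_inj : injective pt.
  by move=> i j /eqP; rewrite nth_uniq // => /eqP/val_inj.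
have ptP h r : T h r -> r <> 0 -> exists i, h = pt i.
  move=> Thr r0; have hI : h \in I.
    rewrite mem_filter; apply/andP; split; first by apply/asboolP; exists r.
    apply/negPn/negP => /(gc_out gcT); move=> /(_ r); rewrite (gc_homog gcT _ Thr) eqxx.
    exact: r0.
  have hlt : (index h I < n)%N by rewrite index_mem.
  by exists (Ordinal hlt); rewrite /pt /= nth_index.
pose V := 'rV[int]_n; pose delta i : V := delta_mx 0 i.
pose ev (D : zmodType) (f : H -> D) (v : V) := \sum_(i < n) f (pt i) *~ v 0 i.
have evD (D : zmodType) (f : H -> D) x y : ev D f (x + y) = ev D f x + ev D f y.
  by rewrite -big_split; apply: eq_bigr => i _; rewrite mxE mulrzDr.
have evN (D : zmodType) (f : H -> D) x : ev D f (- x) = - ev D f x.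
  by rewrite -sumrN; apply: eq_bigr => i _; rewrite mxE mulrNz.
have ev_delta (D : zmodType) (f : H -> D) i : ev D f (delta i) = f (pt i).
  rewrite /ev (bigD1 i) //= mxE !eqxx mulr1z big1 ?addr0 // => j neqji.
  by rewrite mxE eqxx (negPf neqji) mulr0z.
have deltaE (v : V) : v = \sum_i delta i *~ v 0 i.
  rewrite {1}(row_sum_delta v); apply: eq_bigr => i _.
  by rewrite -scaler_int intz.
(* Because K collects all that every coarsening kills, an identity in G is proved by checking it
   after an arbitrary coarsening. *)
pose K (v : V) := forall (D : zmodType) (S : D -> R -> Prop), e_grading iota e S ->
  forall f, coarsens S f -> ev D f v = 0.
have [||G [q [q_surj qK]]] := @zmod_quotient V K.
- by move=> D S _ f _; rewrite /ev big1 // => i _; rewrite mxE mulr0z.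
- by move=> x y Kx Ky D S egS f fS; rewrite evD evN (Kx _ _ egS) // (Ky _ _ egS) // subr0.
have q_eq x y : q x = q y <-> K (x - y).
  by rewrite -qK raddfB; split=> [->|/eqP]; rewrite ?subrr // subr_eq0 => /eqP.
pose ei i := q (delta i).
have idT : coarsens T id by [].
have lift (D : zmodType) (S : D -> R -> Prop) f : e_grading iota e S -> coarsens S f ->
    exists phi : G -> D, (forall x y, phi (x + y) = phi x + phi y) /\
      forall i, phi (ei i) = f (pt i).
  move=> egS fS; have [sec secK] := choice q_surj.
  have phiE v : ev D f (sec (q v)) = ev D f v.
    have /q_eq/(_ D S egS f fS) : q (sec (q v)) = q v by exact: secK.
    by rewrite evD evN => /eqP; rewrite subr_eq0 => /eqP.
  exists (fun x => ev D f (sec x)); split=> [x y|i]; last by rewrite phiE ev_delta.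
  have [u <-] := q_surj x; have [v <-] := q_surj y.
  by rewrite -raddfD !phiE evD.
(* T coarsens itself by the identity, so theta recovers the degree in H and the generators [ei] stay
   distinct. *)
have [theta [_ thetaE]] := lift H T id egT idT.
have ei_inj : injective ei by move=> i j eqij; apply: pt_inj; rewrite -!thetaE eqij.
pose M g r := r = 0 \/ exists2 i, g = ei i & T (pt i) r.
have T0 h : T h 0 by case: (kT h).
have compM r : r = \sum_(i < n) comp (pt i) r.
  rewrite -{1}(gc_sum gcT r).
  have -> : \sum_(h <- s) comp h r = \sum_(h <- I) comp h r.
    rewrite /I big_filter [RHS]big_mkcond; apply: eq_bigr => h _.
    case: asboolP => // noh; apply: contrapT => cr; apply: noh.
    by exists (comp h r) => //; exact: (gc_mem gcT).
  by rewrite (big_nth 0) big_mkord.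
have M_comp i r : M (ei i) (comp (pt i) r).
  by right; exists i => //; exact: (gc_mem gcT).
have grM : is_grading iota M.
  split.
  - move=> g; split=> [|x y [->|[i gi Tx]]|c x [->|[i gi Tx]]].
    + by left.
    + by rewrite add0r.
    + case=> [->|[j gj Ty]]; first by rewrite addr0; right; exists i.
      have eqij : i = j by apply: ei_inj; rewrite -gi -gj.
      right; exists i => //; have [_ + _] := kT (pt i); apply=> //.
      by rewrite eqij.
    + by left; rewrite mulr0.
    + by right; exists i => //; have [_ _] := kT (pt i); apply.
  - move=> r; pose l := [seq ei i | i <- enum 'I_n].
    exists l, (fun g => if g \in l then comp (theta g) r else 0); split.
      by rewrite map_inj_uniq ?enum_uniq.
    split=> [g|].
      case: ifP => [/mapP[i _ ->]|_]; last by left.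
      by rewrite thetaE; exact: M_comp.
    rewrite [LHS]compM big_map big_enum; apply: eq_bigr => i _.
    by rewrite map_f ?mem_enum // thetaE.
  - move=> l x ul Mx sum0 g gl; have [//|[i gi Tx]] := Mx g.
    have := congr1 (comp (pt i)) sum0.
    rewrite (gc0 gcT) (gc_big gcT) (bigD1_seq g) //= (gc_homog gcT _ Tx) eqxx.
    rewrite big1 ?addr0 // => h neqhg; have [->|[j hj Th]] := Mx h; first exact: (gc0 gcT).
    rewrite (gc_homog gcT _ Th); case: eqP => // /pt_inj eqij.
    by case/eqP: neqhg; rewrite hj gi eqij.
  - have [R0|R1] := pselect ((1 : R) = 0); first by left.
    have [i pti] := ptP _ _ T1 R1; right; exists i; last by rewrite -pti.
    apply/esym/qK => D S egS f fS; rewrite ev_delta -pti.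
    exact: coarsens0 egS.2 fS R1.
  move=> g h a b [->|[i -> Ta]]; first by rewrite mul0r; left.
  case=> [->|[j -> Tb]]; first by rewrite mulr0; left.
  have [ab0|ab0] := pselect (a * b = 0); first by left.
  have [l ptl] := ptP _ _ (TM _ _ _ _ Ta Tb) ab0.
  right; exists l; last by rewrite -ptl; exact: TM.
  rewrite /ei -raddfD; apply/q_eq => D S egS f fS.
  rewrite evD evD evN !ev_delta -ptl (coarsensD egS.2 fS Ta Tb ab0) subrr.
  by [].
have genG (P : G -> Prop) : P 0 -> (forall x y, P x -> P y -> P (x + y)) ->
    (forall i z, P (ei i *~ z)) -> forall g, P g.
  move=> P0 PD Pe g; have [v <-] := q_surj g; rewrite (deltaE v) raddf_sum.
  by elim/big_rec: _ => // i x _ Px; rewrite raddfMz; apply: PD => //; exact: Pe.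
have torG : e_torsion e G.
  apply/e_torsionP; apply: genG => [||i z].
  - have [m me _] := (e_torsionP e H).1 torT 0.
    by exists m; rewrite ?mul0rn.
  - by move=> x y; exact: torsion_dvdD.
  have [m me ptm] := (e_torsionP e H).1 torT (pt i).
  have [r Tr r0] := pt_nz i; exists m => //.
  rewrite pmulrn mulrzAC -pmulrn -raddfMn.
  have -> : q (delta i *+ m) = 0; last by rewrite mul0rz.
  apply/qK => D S egS f fS.
  have -> : ev D f (delta i *+ m) = f (pt i) *+ m.
    rewrite -ev_delta; elim: (m) => [|j IHj]; last by rewrite !mulrS evD IHj.
    by rewrite !mulr0n /ev big1 // => j _; rewrite mxE mulr0z.
  exact: (@coarsens_torsion D S f egS.2 fS _ r m Tr r0 ptm).
exists G, M; split=> // D S torD grS.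
have egS : e_grading iota e S by [].
have [f fS] := exists_coarsens egS; have [phi [phiD phiE]] := lift D S f egS fS.
have [t [comp' gcS]] := grading_components grS genR.
have kS d : ksubmod iota (S d) by case: grS.
exists phi; split=> // [d r|psi psiD psiS].
  split=> [Sr|[l [x [Mx ->]]]]; last first.
    rewrite big_seq; apply: (ksubmod_sum _ (kS d)) => g /Mx[<- [->|[i -> Tx]]].
      by case: (kS (phi g)).
    by rewrite phiE; exact: fS.
  exists [seq ei i | i <- enum 'I_n & f (pt i) == d], (fun g => comp (theta g) r).
  split=> [g /mapP[i]|].
    by rewrite mem_filter => /andP[/eqP fi _] ->; rewrite phiE thetaE; split.
  rewrite big_map big_filter big_enum_cond /= -[LHS]((gc_memP gcS d r).1 Sr).
  rewrite {1}(compM r) (gc_big gcS) [RHS]big_mkcond; apply: eq_bigr => i _.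
  rewrite (gc_homog gcS _ (fS _ _ (gc_mem gcT (pt i) r))) thetaE eq_sym.
  by [].
(* A nonzero element of T (pt i) lies in the components of S at both values, so psi is forced on
   generators. *)
have psi_ei i : psi (ei i) = phi (ei i).
  have [r Tr r0] := pt_nz i; rewrite phiE.
  apply: degree_unique grS _ (fS _ _ Tr) r0; apply/psiS.
  exists [:: ei i], (fun=> r); rewrite big_seq1; split=> // g.
  by rewrite inE => /eqP->; split=> //; right; exists i.
have [psi' psi'E] := additive_pack psiD; have [phi' phi'E] := additive_pack phiD.
move=> g; rewrite -psi'E -phi'E; move: g; apply: genG => [|x y Px Py|i z].
- by rewrite !raddf0.
- by rewrite !raddfD Px Py.
by rewrite !raddfMz psi'E phi'E psi_ei.
Qed.
End Universal.

Unset Implicit Arguments.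

Theorem mainTheorem7 (e : steinitz) (k R : comPzRingType)
  (iota : {rmorphism k -> R}) :
  noetherian k ->
  reduced R ->
  kmod_fin_gen iota ->
  (forall p, prime_dvd_st p e ->
     (forall r : R, (forall n, exists y : R, r = (p ^ n)%:R * y) -> r = 0) /\
     (forall r : R, p%:R * r = 0 -> r = 0)) ->
  exists (G : zmodType) (M : G -> R -> Prop), universal_grading iota e M.
Proof.
move=> noek redR genR sepR.
have [H [T [egT unsT]]] := exists_unsplittable_grading noek redR genR sepR.
exact: exists_universal_grading egT unsT.
Qed.
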